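(* Let $\mathcal{E}$ be a vector sheaf of rank $n$ over $X$. Then $\mathcal{E}$ is associated with its principal sheaf of frames $\mathcal{P}(\mathcal{E})$ with respect to the trivial representation $\varphi=\mathrm{id}:\mathcal{GL}(n,\mathcal{A})\to\mathcal{GL}(n,\mathcal{A})$; that is, $\mathcal{E}$ is isomorphic, as an $\mathcal{A}$-module, to the vector sheaf associated with $\mathcal{P}(\mathcal{E})$ by $\mathrm{id}$. Hence, the $\mathcal{A}$-linear connections on $\mathcal{E}$ correspond bijectively to the connections on $\mathcal{P}(\mathcal{E})$.
   Context: $X$ is a topological space, $\mathcal{A}$ a sheaf over $X$ of unital, commutative, associative $\mathbb{K}$-algebras ($\mathbb{K}=\mathbb{R},\mathbb{C}$), and $(\mathcal{A},d,\Omega^1)$ a differential triad: $\Omega^1$ is an $\mathcal{A}$-module and $d:\mathcal{A}\to\Omega^1$ is $\mathbb{K}$-linear with $d(s\cdot t)=s\cdot d(t)+t\cdot d(s)$. A vector sheaf of rank $n$ is a locally free $\mathcal{A}$-module $\mathcal{E}$; fix an open cover $\mathcal{U}=\{U_\alpha\mid\alpha\in I\}$ of $X$ and $\mathcal{A}|_{U_\alpha}$-isomorphisms $\psi_\alpha:\mathcal{A}^n|_{U_\alpha}\to\mathcal{E}|_{U_\alpha}$. $\mathcal{GL}(n,\mathcal{A})$ is the sheaf of groups with $\mathcal{GL}(n,\mathcal{A})(U)\cong GL(n,\mathcal{A}(U))\cong\mathrm{Iso}_{\mathcal{A}|_U}(\mathcal{A}^n|_U,\mathcal{A}^n|_U)$;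 $M_n(\mathcal{A})$ is the sheaf of Lie algebras with $M_n(\mathcal{A})(U)\cong M_n(\mathcal{A}(U))$. $\mathcal{A}d(g)(a)=g\cdot a\cdot g^{-1}$ is the adjoint representation of $\mathcal{GL}(n,\mathcal{A})$ in $M_n(\mathcal{A})$; it acts on $\Omega^1\otimes_{\mathcal{A}}M_n(\mathcal{A})$ by $\mathcal{A}d(g).(\theta\otimes u)=\theta\otimes\mathcal{A}d(g)(u)$. The Maurer-Cartan differential $\widetilde\partial:\mathcal{GL}(n,\mathcal{A})\to\Omega^1\otimes_{\mathcal{A}}M_n(\mathcal{A})$ is $\widetilde\partial(a)=a^{-1}\cdot(da_{ij})$ for $a=(a_{ij})$, with $(\Omega^1\otimes_{\mathcal{A}}M_n(\mathcal{A}))(U)\cong M_n(\Omega^1(U))$. Sheaf of frames: let $\mathcal{B}$ be the basis of the topology of $X$ consisting of the open $V$ contained in some $U_\alpha$. $\mathcal{P}(\mathcal{E})$ is the sheaf generated by the complete presheaf $\mathcal{B}\ni V\mapsto\mathrm{Iso}_{\mathcal{A}|_V}(\mathcal{A}^n|_V,\mathcal{E}|_V)$ ($\mathcal{A}|_V$-linear isomorphisms). $\mathcal{GL}(n,\mathcal{A})$ acts on its right by $f\cdot g:=f\circ g$. With the local equivariant isomorphisms $\Phi_\alpha:\mathcal{P}(\mathcal{E})|_{U_\alpha}\to\mathcal{GL}(n,\mathcal{A})|_{U_\alpha}$, $f\mapsto\psi_\alpha^{-1}\circ f$, it is a principal sheaf with structure sheaf $\mathcal{GL}(n,\mathcal{A})$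 (i.e. a sheaf with a right action of that sheaf of groups, locally equivariantly isomorphic to it), and its natural sections are $\sigma_\alpha=\Phi_\alpha^{-1}(\mathrm{id})=\psi_\alpha\in\mathcal{P}(\mathcal{E})(U_\alpha)$. The sheaf associated with $\mathcal{P}(\mathcal{E})$ by $\varphi=\mathrm{id}$ is the sheaf $\mathcal{F}$ generated by $V\mapsto\mathcal{P}(\mathcal{E})(V)\times\mathcal{A}^n(V)/\sim$, where $(s,a)\sim(t,b)\iff\exists!\,g\in\mathcal{GL}(n,\mathcal{A})(V)$: $t=s\cdot g$, $b=g^{-1}\cdot a$. The maps $a\mapsto[\sigma_\alpha|_V,a]$ generate isomorphisms $\Psi_\alpha:\mathcal{A}^n|_{U_\alpha}\to\mathcal{F}|_{U_\alpha}$, and $\mathcal{F}$ has the (well-defined) $\mathcal{A}$-module structure making all $\Psi_\alpha$ linear; it is a vector sheaf of rank $n$. A connection on $\mathcal{P}(\mathcal{E})$ is a morphism of sheaves of sets $D:\mathcal{P}(\mathcal{E})\to\Omega^1\otimes_{\mathcal{A}}M_n(\mathcal{A})$ with $D(s\cdot g)=\mathcal{A}d(g^{-1}).D(s)+\widetilde\partial(g)$ for all sections $s\in\mathcal{P}(\mathcal{E})(U)$, $g\in\mathcal{GL}(n,\mathcal{A})(U)$. Its local connection forms are $\omega_\alpha:=D(\sigma_\alpha)$. An $\mathcal{A}$-(linear) connection on $\mathcal{E}$ is a $\mathbb{K}$-linear morphism $\nabla:\mathcal{E}\to\mathcal{E}\otimes_{\mathcal{A}}\Omega^1$ with $\nabla(a\cdot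 s)=a\cdot\nabla(s)+s\otimes d(a)$. With $e^\alpha$ the basis of $\mathcal{E}(U_\alpha)$ that is the image of the standard basis under $\psi_\alpha$, its local connection forms $\theta_\alpha=(\theta^\alpha_{ij})\in M_n(\Omega^1(U_\alpha))$ are given by $\nabla(e^\alpha_j)=\sum_{i=1}^n e^\alpha_i\otimes\theta^\alpha_{ij}$. The bijective correspondence is the one in which $D$ and $\nabla$ correspond when $\theta_\alpha=\omega_\alpha$ for all $\alpha\in I$. *)

(* Defs.v *)
From HB Require Import structures.
From mathcomp Require Import all_boot all_order all_algebra.
From mathcomp Require Import boolp classical_sets reals topology_structure.
From mathcomp Require Import complex.

Set Implicit Arguments.
Unset Strict Implicit.
Unset Printing Implicit Defensive.

Import Order.TTheory GRing.Theory Num.Theory.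

Local Open Scope classical_set_scope.
Local Open Scope ring_scope.

Variant ground_field := GroundReal | GroundComplex.

Definition scalars (R : realType) (k : ground_field) : fieldType :=
  match k with GroundReal => R : fieldType | GroundComplex => R[i] : fieldType end.

Lemma sval_inj (T : Type) (P : T -> Prop) (u v : {x | P x}) :
  sval u = sval v -> u = v.
Proof.
case: u v => [x p] [y q] /= e; case: y / e q => q; by rewrite (Prop_irrelevance p q).
Qed.

Section Quotient.
Variables (T : Type) (R : T -> T -> Prop).

(* The classes of R, as predicates; a quotient once R is an equivalence. *)
Definition quotient := {c : T -> Prop | exists t, c = R t}.

Definition qpi (t : T) : quotient := exist _ (R t) (ex_intro _ t erefl).

Definition qrepr (c : quotient) : T := projT1 (cid (svalP c)).

Lemma qreprK c : qpi (qrepr c) = c.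
Proof.
apply: sval_inj; by rewrite /= /qrepr; case: cid => t /= ->.
Qed.

Lemma qpiP (eR : RelationClasses.Equivalence R) t u : qpi t = qpi u <-> R t u.
Proof.
case: eR => r s tr; split=> [[e]|h].
  by rewrite e; exact: r.
apply: sval_inj; apply/funext => v; apply/propext; split=> h'.
  exact: tr (s _ _ h) h'.
exact: tr h h'.
Qed.

Lemma qrepr_pi (eR : RelationClasses.Equivalence R) t : R (qrepr (qpi t)) t.
Proof. by apply/(qpiP eR); rewrite qreprK. Qed.

End Quotient.

Section Presheaves.
Variable X : topologicalType.

Record opens := Opens { oset :> set X; open_oset : open oset }.

Definition opens_mem (U : opens) (x : X) : Prop := oset U x.
Coercion opens_mem : opens >-> Funclass.

Definition opensT : opens := Opens openT.
Definition opensI (U V : opens) : opens :=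
  Opens (openI (open_oset U) (open_oset V)).

Lemma opensIl U V : opensI U V `<=` U. Proof. by move=> x []. Qed.
Lemma opensIr U V : opensI U V `<=` V. Proof. by move=> x []. Qed.

Definition covers (I : Type) (U : I -> opens) (V : set X) :=
  forall x, V x -> exists i, U i x.

Record presheaf := Presheaf {
  psec :> opens -> Type;
  pres : forall U V : opens, V `<=` U -> psec U -> psec V;
  pres_id : forall (U : opens) (h : U `<=` U) s, pres h s = s;
  pres_comp : forall (U V W : opens) (h : V `<=` U) (h' : W `<=` V)
    (h'' : W `<=` U) s, pres h' (pres h s) = pres h'' s }.

Definition is_sheaf (F : presheaf) : Prop :=
  forall (U : opens) (I : Type) (V : I -> opens) (hV : forall i, V i `<=` U),
  covers V U ->
  forall s : forall i, F (V i),
  (forall i j, pres (@opensIl (V i) (V j)) (s i)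
             = pres (@opensIr (V i) (V j)) (s j)) ->
  exists! t : F U, forall i, pres (hV i) t = s i.

Record psh_map (F G : presheaf) := PshMap {
  pmap :> forall U, F U -> G U;
  pmap_res : forall (U V : opens) (h : V `<=` U) s,
    pmap (pres h s) = pres h (pmap s) }.

Record psh_op (F G H : presheaf) := PshOp {
  pop :> forall U, F U -> G U -> H U;
  pop_res : forall (U V : opens) (h : V `<=` U) s t,
    pres h (pop s t) = pop (pres h s) (pres h t) }.

Lemma sheaf_sep (F : presheaf) (shF : is_sheaf F) (U : opens) (I : Type)
    (V : I -> opens) (hV : forall i, V i `<=` U) (s t : F U) :
  covers V U -> (forall i, pres (hV i) s = pres (hV i) t) -> s = t.
Proof.
move=> cV e.
have [|u [_ uu]] := shF U I V hV cV (fun i => pres (hV i) s).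
  by move=> i j; rewrite !(pres_comp _ _ (subset_trans (@opensIl _ _) (hV i))).
by rewrite -(uu s) // -(uu t).
Qed.

Lemma sheaf_sep_loc (F : presheaf) (shF : is_sheaf F) (U : opens) (s t : F U) :
  (forall x, U x -> exists W : opens, exists h : W `<=` U,
     W x /\ pres h s = pres h t) -> s = t.
Proof.
move=> H.
pose I := {W : opens | exists h : W `<=` U, pres h s = pres h t}.
have hV (i : I) : sval i `<=` U by case: i => W [].
apply: (sheaf_sep shF (V := fun i : I => sval i) (hV := hV)).
  move=> x /H [W [h [Wx e]]].
  by exists (exist (fun W : opens => exists h : W `<=` U, pres h s = pres h t)
               W (ex_intro _ h e)).
by move=> i; case: (svalP i) => h e; rewrite (Prop_irrelevance (hV i) h).
Qed.

(* The sheaf generated by a presheaf F: its sections over U are the families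
   of germs (s x) for x in U that are locally given by sections of F. *)

Section Generated.
Variable F : presheaf.

Record germ_rep (x : X) := GermRep {
  gr_open : opens; gr_mem : gr_open x; gr_sec : F gr_open }.

Definition germ_eq x (p q : germ_rep x) : Prop :=
  exists W : opens, W x /\
  exists (h : W `<=` gr_open p) (h' : W `<=` gr_open q),
    pres h (gr_sec p) = pres h' (gr_sec q).

Lemma germ_eq_equiv x : RelationClasses.Equivalence (@germ_eq x).
Proof.
split.
- move=> p; exists (gr_open p); split; first exact: gr_mem.
  by exists (@subset_refl _ _), (@subset_refl _ _).
- by move=> p q [W [Wx [h [h' e]]]]; exists W; split=> //; exists h', h.
- move=> p q r [W [Wx [h [h' e]]]] [W' [Wx' [k [k' e']]]].
  exists (opensI W W'); split; first by split.
  exists (subset_trans (@opensIl _ _) h), (subset_trans (@opensIr _ _) k').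
  rewrite -(pres_comp h (@opensIl _ _)) e.
  rewrite -(pres_comp k' (@opensIr _ _)) -e'.
  by rewrite !(pres_comp _ _ (subset_trans (@opensIl _ _) h')).
Qed.

Definition stalk (x : X) := quotient (@germ_eq x).

Definition germ (U : opens) x (Ux : U x) (s : F U) : stalk x :=
  qpi _ (GermRep Ux s).

Lemma germP (U V : opens) x (Ux : U x) (Vx : V x) s t :
  germ Ux s = germ Vx t <->
  exists W : opens, W x /\ exists (h : W `<=` U) (h' : W `<=` V),
    pres h s = pres h' t.
Proof. exact: (qpiP (germ_eq_equiv x)). Qed.

Lemma germ_res (U V : opens) (h : V `<=` U) x (Ux : U x) (Vx : V x) s :
  germ Vx (pres h s) = germ Ux s.
Proof.
apply/germP; exists V; split=> //; exists (@subset_refl _ _), h.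
by rewrite pres_id.
Qed.

Lemma stalkP x (c : stalk x) : exists (U : opens) (Ux : U x) s, c = germ Ux s.
Proof.
exists (gr_open (qrepr c)), (gr_mem (qrepr c)), (gr_sec (qrepr c)).
by rewrite -[LHS]qreprK /germ; case: (qrepr c).
Qed.

Definition loc_rep (U : opens) (s : forall x, U x -> stalk x) : Prop :=
  forall x, U x -> exists V : opens, V x /\ exists (h : V `<=` U) (t : F V),
    forall y (Vy : V y), s y (h y Vy) = germ Vy t.

Definition gen_sec (U : opens) := {s : forall x, U x -> stalk x | loc_rep s}.

Lemma gen_sec_eq U (s t : gen_sec U) :
  (forall x Ux, sval s x Ux = sval t x Ux) -> s = t.
Proof. by move=> e; apply: sval_inj; do 2!apply: functional_extensionality_dep => ?. Qed.

Lemma gen_res_subproof (U V : opens) (h : V `<=` U) (s : gen_sec U) :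
  @loc_rep V (fun x Vx => sval s x (h x Vx)).
Proof.
move=> x Vx; have [W [Wx [k [t e]]]] := svalP s x (h x Vx).
exists (opensI V W); split; first by split.
exists (@opensIl _ _), (pres (@opensIr _ _) t) => y VWy.
rewrite (germ_res _ (proj2 VWy)) -e; congr (sval s y _); exact: Prop_irrelevance.
Qed.

Definition gen_res (U V : opens) (h : V `<=` U) (s : gen_sec U) : gen_sec V :=
  exist _ _ (gen_res_subproof h s).

Lemma gen_res_id (U : opens) (h : U `<=` U) s : gen_res h s = s.
Proof.
by apply: gen_sec_eq => x Ux /=; congr (sval s x _); exact: Prop_irrelevance.
Qed.

Lemma gen_res_comp (U V W : opens) (h : V `<=` U) (h' : W `<=` V)
  (h'' : W `<=` U) s : gen_res h' (gen_res h s) = gen_res h'' s.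
Proof.
by apply: gen_sec_eq => x Ux /=; congr (sval s x _); exact: Prop_irrelevance.
Qed.

Definition generated : presheaf := Presheaf gen_res_id gen_res_comp.

Lemma generated_sheaf : is_sheaf generated.
Proof.
move=> U I V hV cV s cs.
have cs' i j x (xi : V i x) (xj : V j x) : sval (s i) x xi = sval (s j) x xj.
  have /(congr1 (fun u => sval u x (conj xi xj))) := cs i j.
  rewrite /=; rewrite (Prop_irrelevance (opensIl _) xi).
  by rewrite (Prop_irrelevance (opensIr _) xj).
pose t x (Ux : U x) : stalk x :=
  let j := cid (cV x Ux) in sval (s (projT1 j)) x (projT2 j).
have tE i x (Ux : U x) (xi : V i x) : t x Ux = sval (s i) x xi by exact: cs'.
have lt : loc_rep t.
  move=> x Ux; have [i xi] := cV x Ux.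
  have [W [Wx [h [u e]]]] := svalP (s i) x xi.
  exists W; split=> //; exists (subset_trans h (hV i)), u => y Wy.
  by rewrite (tE i _ _ (h y Wy)) e.
exists (exist _ t lt); split.
  by move=> i; apply: gen_sec_eq => x xi /=; exact: tE.
move=> t' et'; apply: gen_sec_eq => x Ux /=; have [i xi] := cV x Ux.
rewrite (tE i _ _ xi) -et' /=; congr (sval t' x _); exact: Prop_irrelevance.
Qed.

Lemma eta_subproof U (s : F U) : @loc_rep U (fun x Ux => germ Ux s).
Proof.
move=> x Ux; exists U; split=> //; exists (@subset_refl _ _), s => y Uy.
by rewrite (Prop_irrelevance (subset_refl _) Uy).
Qed.

Lemma eta_res (U V : opens) (h : V `<=` U) s :
  exist _ _ (eta_subproof (pres h s)) =
  pres h (exist _ _ (eta_subproof s) : generated U).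
Proof. by apply: gen_sec_eq => x Vx /=; rewrite (germ_res _ (h x Vx)). Qed.

Definition eta : psh_map F generated :=
  @PshMap F generated (fun U s => exist _ _ (eta_subproof s)) eta_res.

Lemma generatedP (U : opens) (s : generated U) x : U x ->
  exists V : opens, V x /\ exists (h : V `<=` U) (t : F V), pres h s = eta V t.
Proof.
move=> Ux; have [V [Vx [h [t e]]]] := svalP s x Ux.
exists V; split=> //; exists h, t; apply: gen_sec_eq => y Vy; exact: e.
Qed.

Lemma eta_eqP (U : opens) (s t : F U) : eta U s = eta U t <->
  forall x, U x -> exists W : opens, exists h : W `<=` U,
    W x /\ pres h s = pres h t.
Proof.
split=> [e x Ux|H].
  have /(congr1 (fun u => sval u x Ux)) /= /germP [W [Wx [h [h' e']]]] := e.
  by exists W, h; split=> //; rewrite e' (Prop_irrelevance h h').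
apply: gen_sec_eq => x Ux /=; have [W [h [Wx e]]] := H x Ux.
by apply/germP; exists W; split=> //; exists h, h.
Qed.

End Generated.

Lemma stalkP2 (F G : presheaf) x (c : stalk F x) (c' : stalk G x) :
  exists (U : opens) (Ux : U x) s t, c = germ Ux s /\ c' = germ Ux t.
Proof.
have [U [Ux [s ->]]] := stalkP c; have [V [Vx [t ->]]] := stalkP c'.
have Ix : opensI U V x by [].
exists (opensI U V), Ix, (pres (@opensIl _ _) s), (pres (@opensIr _ _) t).
by rewrite (germ_res _ Ux) (germ_res _ Vx).
Qed.

Lemma stalkP3 (F G H : presheaf) x
    (c : stalk F x) (c' : stalk G x) (c'' : stalk H x) :
  exists (U : opens) (Ux : U x) s t r, [/\ c = germ Ux s, c' = germ Ux t & c'' = germ Ux r].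
Proof.
have [U [Ux [s [t [-> ->]]]]] := stalkP2 c c'; have [V [Vx [r ->]]] := stalkP c''.
have Ix : opensI U V x by [].
exists (opensI U V), Ix, (pres (@opensIl _ _) s), (pres (@opensIl _ _) t),
  (pres (@opensIr _ _) r).
by rewrite !(germ_res _ Ux) (germ_res _ Vx).
Qed.

Section GeneratedOp.
Variables (F G H : presheaf) (op : psh_op F G H).

Definition stalk_op x (c : stalk F x) (c' : stalk G x) : stalk H x :=
  let p := qrepr c in let q := qrepr c' in
  germ (conj (gr_mem p) (gr_mem q) : opensI (gr_open p) (gr_open q) x)
    (op _ (pres (@opensIl _ _) (gr_sec p)) (pres (@opensIr _ _) (gr_sec q))).

Lemma stalk_opE (U : opens) x (Ux : U x) s t :
  stalk_op (germ Ux s) (germ Ux t) = germ Ux (op U s t).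
Proof.
rewrite /stalk_op.
have [] := (qrepr_pi (germ_eq_equiv F x) (GermRep Ux s),
            qrepr_pi (germ_eq_equiv G x) (GermRep Ux t)).
rewrite -!/(germ _ _).
move: (qrepr (germ Ux s)) (qrepr (germ Ux t)) => p q.
move=> [W [Wx [h [h' e]]]] [W' [Wx' [k [k' e']]]] /=.
apply/germP; exists (opensI W W'); split=> //.
have j : opensI W W' `<=` opensI (gr_open p) (gr_open q).
  by move=> y [y1 y2]; split; [exact: (h _ y1) | exact: (k _ y2)].
exists j, (subset_trans (@opensIl _ _) h'); rewrite !pop_res; congr (op _ _ _).
  rewrite (pres_comp _ _ (subset_trans (@opensIl _ _) h)).
  by rewrite -(pres_comp h (@opensIl _ _)) e (pres_comp _ _ (subset_trans (@opensIl _ _) h')).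
rewrite (pres_comp _ _ (subset_trans (@opensIr _ _) k)).
rewrite -(pres_comp k (@opensIr _ _)) e' (pres_comp _ _ (subset_trans (@opensIr _ _) k')).
by rewrite (Prop_irrelevance (subset_trans _ _) (subset_trans (@opensIl W W') h')).
Qed.

Lemma gen_op_subproof (U : opens) (s : generated F U) (t : generated G U) :
  loc_rep (fun x Ux => stalk_op (sval s x Ux) (sval t x Ux)).
Proof.
move=> x Ux; have [V [Vx [h [u e]]]] := svalP s x Ux.
have [V' [Vx' [h' [u' e']]]] := svalP t x Ux.
exists (opensI V V'); split=> //.
exists (subset_trans (@opensIl _ _) h),
  (op _ (pres (@opensIl _ _) u) (pres (@opensIr _ _) u')) => y [Vy Vy'].
rewrite -stalk_opE (germ_res _ Vy) (germ_res _ Vy') -e -e'.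
by congr (stalk_op (sval s y _) (sval t y _)); exact: Prop_irrelevance.
Qed.

Lemma gen_op_res (U V : opens) (h : V `<=` U) (s : generated F U)
    (t : generated G U) :
  pres h (exist _ _ (gen_op_subproof s t) : generated H U) =
  exist _ _ (gen_op_subproof (pres h s) (pres h t)).
Proof. by apply: gen_sec_eq. Qed.

Definition gen_op : psh_op (generated F) (generated G) (generated H) :=
  @PshOp (generated F) (generated G) (generated H)
    (fun U s t => exist _ _ (gen_op_subproof s t)) gen_op_res.

Lemma gen_op_eta U (s : F U) (t : G U) : gen_op U (eta F U s) (eta G U t) = eta H U (op U s t).
Proof. by apply: gen_sec_eq => x Ux /=; rewrite stalk_opE. Qed.

End GeneratedOp.
End Presheaves.

Arguments opensT {X}.
Arguments eta {X F}.

(* Tensor product of modules over a commutative ring: the formal sums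
   [:: (m1, n1); ...; (mk, nk)], standing for the sum of the mi ⊗ ni, modulo the
   congruence generated by bilinearity. Tens0 is what makes the quotient monoid
   a group. *)

Section Tensor.
Variables (R : comPzRingType) (M N : lmodType R).

Inductive tens_eq : seq (M * N) -> seq (M * N) -> Prop :=
| TensRefl s : tens_eq s s
| TensSym s t : tens_eq s t -> tens_eq t s
| TensTrans s t u : tens_eq s t -> tens_eq t u -> tens_eq s u
| TensCat s s' t t' :
    tens_eq s s' -> tens_eq t t' -> tens_eq (s ++ t) (s' ++ t')
| TensC s t : tens_eq (s ++ t) (t ++ s)
| TensDl m m' n : tens_eq [:: (m + m', n)] [:: (m, n); (m', n)]
| TensDr m n n' : tens_eq [:: (m, n + n')] [:: (m, n); (m, n')]
| TensZ a m n : tens_eq [:: (a *: m, n)] [:: (m, a *: n)]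
| Tens0 n : tens_eq [:: (0, n)] [::].

Lemma tens_eq_equiv : RelationClasses.Equivalence tens_eq.
Proof.
split=> [s|s t|s t u]; [exact: TensRefl|exact: TensSym|exact: TensTrans].
Qed.

Definition tensor := quotient tens_eq.

HB.instance Definition _ := gen_eqMixin tensor.
HB.instance Definition _ := gen_choiceMixin tensor.

Definition tens (s : seq (M * N)) : tensor := qpi tens_eq s.

Lemma tensP s t : tens s = tens t <-> tens_eq s t.
Proof. exact: (qpiP tens_eq_equiv). Qed.

Lemma tensE (c : tensor) : exists s, c = tens s.
Proof. by exists (qrepr c); rewrite /tens qreprK. Qed.

Lemma tens_repr s : tens_eq (qrepr (tens s)) s.
Proof. exact: (qrepr_pi tens_eq_equiv). Qed.

Definition tens_add (c c' : tensor) : tensor := tens (qrepr c ++ qrepr c').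

Lemma tens_addE s t : tens_add (tens s) (tens t) = tens (s ++ t).
Proof. by apply/tensP; apply: TensCat; exact: tens_repr. Qed.

Definition tens_scale (a : R) (c : tensor) : tensor :=
  tens [seq (a *: p.1, p.2) | p <- qrepr c].

Lemma tens_scaleE a s : tens_scale a (tens s) = tens [seq (a *: p.1, p.2) | p <- s].
Proof.
apply/tensP; move: (tens_repr s); move: (qrepr _) => s'; elim=> {s' s}.
- by move=> s; exact: TensRefl.
- by move=> s t _ ?; exact: TensSym.
- by move=> s t u _ ? _; exact: TensTrans.
- by move=> s s' t t' _ ? _ ?; rewrite !map_cat; exact: TensCat.
- by move=> s t; rewrite !map_cat; exact: TensC.
- by move=> m m' n /=; rewrite scalerDr; exact: TensDl.
- by move=> m n n' /=; exact: TensDr.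
- by move=> b m n /=; rewrite scalerA mulrC -scalerA; exact: TensZ.
- by move=> n /=; rewrite scaler0; exact: Tens0.
Qed.

Let tens_addA : associative tens_add.
Proof.
move=> c c' c''; have [s ->] := tensE c; have [s' ->] := tensE c'.
by have [s'' ->] := tensE c''; rewrite !tens_addE catA.
Qed.

Let tens_addC : commutative tens_add.
Proof.
move=> c c'; have [s ->] := tensE c; have [s' ->] := tensE c'.
by rewrite !tens_addE; apply/tensP; exact: TensC.
Qed.

Let tens_add0 : left_id (tens [::]) tens_add.
Proof. by move=> c; have [s ->] := tensE c; rewrite tens_addE. Qed.

Lemma tens_cons p s : tens (p :: s) = tens_add (tens [:: p]) (tens s).
Proof. by rewrite tens_addE. Qed.

Lemma tens_ind (P : tensor -> Prop) : P (tens [::]) ->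
  (forall m n, P (tens [:: (m, n)])) ->
  (forall c c', P c -> P c' -> P (tens_add c c')) -> forall c, P c.
Proof.
move=> P0 P1 PD c; have [s ->] := tensE c.
by elim: s => [//|[m n] s IH]; rewrite tens_cons; exact: PD.
Qed.

Lemma tens_scaleDr a : {morph tens_scale a : c c' / tens_add c c'}.
Proof.
move=> c c'; have [s ->] := tensE c; have [s' ->] := tensE c'.
by rewrite !(tens_addE, tens_scaleE) map_cat.
Qed.

Let tens_scaleDl c a b : tens_scale (a + b) c = tens_add (tens_scale a c) (tens_scale b c).
Proof.
elim/tens_ind: c => [|m n|c c' IH IH'].
- by rewrite !tens_scaleE tens_addE.
- by rewrite !tens_scaleE tens_addE /= scalerDl; apply/tensP; exact: TensDl.
- rewrite !tens_scaleDr IH IH' !tens_addA; congr tens_add.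
  by rewrite -!tens_addA; congr tens_add; exact: tens_addC.
Qed.

Let tens_scaleA a b c : tens_scale a (tens_scale b c) = tens_scale (a * b) c.
Proof.
have [s ->] := tensE c; rewrite !tens_scaleE -map_comp; congr tens.
by apply: eq_map => p /=; rewrite scalerA.
Qed.

Let tens_scale1 : left_id 1 tens_scale.
Proof.
move=> c; have [s ->] := tensE c; rewrite tens_scaleE; congr tens.
by rewrite -[RHS]map_id; apply: eq_map => -[m n] /=; rewrite scale1r.
Qed.

Let tens_scale0 c : tens_scale 0 c = tens [::].
Proof.
elim/tens_ind: c => [|m n|c c' IH IH'].
- by rewrite tens_scaleE.
- by rewrite tens_scaleE /= scale0r; apply/tensP; exact: Tens0.
- by rewrite tens_scaleDr IH IH' tens_add0.
Qed.

Let tens_addN : left_inverse (tens [::]) (tens_scale (-1)) tens_add.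
Proof.
move=> c; rewrite -[X in tens_add _ X]tens_scale1 -tens_scaleDl addNr.
exact: tens_scale0.
Qed.

HB.instance Definition _ :=
  GRing.isZmodule.Build tensor tens_addA tens_addC tens_add0 tens_addN.

HB.instance Definition _ := GRing.Zmodule_isLmodule.Build R tensor
  tens_scaleA tens_scale1 tens_scaleDr tens_scaleDl.

Lemma tens_addrE s t : tens s + tens t = tens (s ++ t).
Proof. exact: tens_addE. Qed.

Lemma tens_scalerE a s : a *: tens s = tens [seq (a *: p.1, p.2) | p <- s].
Proof. exact: tens_scaleE. Qed.

End Tensor.

Arguments tens {R M N} s.

Section TensorMap.
Variables (R R' : comPzRingType) (phi : R -> R').
Variables (M N : lmodType R) (M' N' : lmodType R') (f : M -> M') (g : N -> N').

Definition tens_map (c : tensor M N) : tensor M' N' :=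
  tens [seq (f p.1, g p.2) | p <- qrepr c].

Hypothesis f_lin : forall a x y, f (a *: x + y) = phi a *: f x + f y.
Hypothesis g_lin : forall a x y, g (a *: x + y) = phi a *: g x + g y.
Hypothesis phi1 : phi 1 = 1.

Let fD x y : f (x + y) = f x + f y.
Proof. by have := f_lin 1 x y; rewrite phi1 !scale1r. Qed.
Let gD x y : g (x + y) = g x + g y.
Proof. by have := g_lin 1 x y; rewrite phi1 !scale1r. Qed.
Let f0 : f 0 = 0.
Proof. by apply: (addrI (f 0)); rewrite -fD !addr0. Qed.
Let g0 : g 0 = 0.
Proof. by apply: (addrI (g 0)); rewrite -gD !addr0. Qed.
Let fZ a x : f (a *: x) = phi a *: f x.
Proof. by have := f_lin a x 0; rewrite !addr0 f0 addr0. Qed.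
Let gZ a x : g (a *: x) = phi a *: g x.
Proof. by have := g_lin a x 0; rewrite !addr0 g0 addr0. Qed.

Lemma tens_mapE s : tens_map (tens s) = tens [seq (f p.1, g p.2) | p <- s].
Proof.
apply/tensP; move: (tens_repr s); move: (qrepr _) => s'; elim=> {s' s}.
- by move=> s; exact: TensRefl.
- by move=> s t _ ?; exact: TensSym.
- by move=> s t u _ ? _; exact: TensTrans.
- by move=> s s' t t' _ ? _ ?; rewrite !map_cat; exact: TensCat.
- by move=> s t; rewrite !map_cat; exact: TensC.
- by move=> m m' n /=; rewrite fD; exact: TensDl.
- by move=> m n n' /=; rewrite gD; exact: TensDr.
- by move=> b m n /=; rewrite fZ gZ; exact: TensZ.
- by move=> n /=; rewrite f0; exact: Tens0.
Qed.

Lemma tens_map_lin a c c' : tens_map (a *: c + c') = phi a *: tens_map c + tens_map c'.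
Proof.
have [s ->] := tensE c; have [s' ->] := tensE c'.
rewrite tens_scalerE tens_addrE !tens_mapE tens_scalerE tens_addrE map_cat.
by congr (tens (_ ++ _)); rewrite -!map_comp; apply: eq_map => p /=; rewrite fZ.
Qed.

End TensorMap.

Section Sheaves.
Variables (K : fieldType) (X : topologicalType).

(* Sections over the empty set form the zero ring, whence the possibly
   trivial rings; the algebra structure is a natural ring morphism from K. *)
Record algebra_sheaf := AlgebraSheaf {
  alg_sec :> opens X -> comPzRingType;
  alg_const : forall U, {rmorphism K -> alg_sec U};
  alg_res : forall U V : opens X, V `<=` U -> {rmorphism alg_sec U -> alg_sec V};
  alg_res_const : forall (U V : opens X) (h : V `<=` U) k,
    alg_res h (alg_const U k) = alg_const V k;
  alg_res_id : forall (U : opens X) (h : U `<=` U) a, alg_res h a = a;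
  alg_res_comp : forall (U V W : opens X) (h : V `<=` U) (h' : W `<=` V)
    (h'' : W `<=` U) a, alg_res h' (alg_res h a) = alg_res h'' a;
  alg_is_sheaf :
    is_sheaf (@Presheaf X (fun U => alg_sec U : Type)
      (fun U V h => alg_res h : alg_sec U -> alg_sec V) alg_res_id alg_res_comp) }.

Section Modules.
Variable A : algebra_sheaf.

Definition alg_psh : presheaf X :=
  @Presheaf X (fun U => A U : Type) (fun U V h => alg_res A h : A U -> A V)
    (@alg_res_id A) (@alg_res_comp A).

Record module_presheaf := ModulePresheaf {
  mod_sec :> forall U : opens X, lmodType (A U);
  mod_res : forall U V : opens X, V `<=` U -> mod_sec U -> mod_sec V;
  mod_res_lin : forall (U V : opens X) (h : V `<=` U) (a : A U) s t,
    mod_res h (a *: s + t) = alg_res A h a *: mod_res h s + mod_res h t;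
  mod_res_id : forall (U : opens X) (h : U `<=` U) s, mod_res h s = s;
  mod_res_comp : forall (U V W : opens X) (h : V `<=` U) (h' : W `<=` V)
    (h'' : W `<=` U) s, mod_res h' (mod_res h s) = mod_res h'' s }.

Definition mod_psh (M : module_presheaf) : presheaf X :=
  @Presheaf X (fun U => M U : Type) (@mod_res M)
    (@mod_res_id M) (@mod_res_comp M).

Record module_sheaf := ModuleSheaf {
  msh_mod :> module_presheaf;
  msh_is_sheaf : is_sheaf (mod_psh msh_mod) }.

(* Isomorphisms M|_V -> N|_V of A|_V-modules, as families over the open
   subsets W of V. *)
Record iso_on (V : opens X) (M N : module_presheaf) := IsoOn {
  iso_app : forall W : opens X, W `<=` V -> M W -> N W;
  iso_lin : forall (W : opens X) (h : W `<=` V) (a : A W) s t,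
    iso_app h (a *: s + t) = a *: iso_app h s + iso_app h t;
  iso_res : forall (W W' : opens X) (h : W `<=` V) (h' : W' `<=` V)
    (k : W' `<=` W) s, iso_app h' (mod_res k s) = mod_res k (iso_app h s);
  iso_bij : forall (W : opens X) (h : W `<=` V), bijective (iso_app h) }.

Definition isomorphic (M N : module_presheaf) := inhabited (iso_on opensT M N).

Lemma iso_eq V M N (f g : iso_on V M N) :
  (forall (W : opens X) (h : W `<=` V) s, iso_app f h s = iso_app g h s) -> f = g.
Proof.
case: f g => [f f1 f2 f3] [g g1 g2 g3] /= e.
have {}e : f = g by do 3!apply: functional_extensionality_dep => ?; exact: e.
by subst g; congr IsoOn; exact: Prop_irrelevance.
Qed.

Definition iso_restrict (V V' : opens X) (k : V' `<=` V) M N (f : iso_on V M N) :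
  iso_on V' M N :=
  @IsoOn V' M N (fun W h => iso_app f (subset_trans h k))
    (fun W h => @iso_lin V M N f W (subset_trans h k))
    (fun W W' h h' => @iso_res V M N f W W' (subset_trans h k) (subset_trans h' k))
    (fun W h => @iso_bij V M N f W (subset_trans h k)).

Section GeneratedModule.
Variable M : module_presheaf.

Lemma mod_resD (U V : opens X) (h : V `<=` U) (s t : M U) :
  mod_res h (s + t) = mod_res h s + mod_res h t.
Proof. by rewrite -[s]scale1r mod_res_lin rmorph1 !scale1r. Qed.

Lemma mod_res0 (U V : opens X) (h : V `<=` U) : mod_res h (0 : M U) = 0.
Proof. by apply: (addrI (mod_res h 0)); rewrite -mod_resD !addr0. Qed.

Lemma mod_resZ (U V : opens X) (h : V `<=` U) a (s : M U) :
  mod_res h (a *: s) = alg_res A h a *: mod_res h s.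
Proof. by rewrite -[a *: s]addr0 mod_res_lin mod_res0 addr0. Qed.

Definition mod_add_op : psh_op (mod_psh M) (mod_psh M) (mod_psh M) :=
  @PshOp X (mod_psh M) (mod_psh M) (mod_psh M) (fun U (s t : M U) => s + t) mod_resD.

Definition mod_scale_op : psh_op alg_psh (mod_psh M) (mod_psh M) :=
  @PshOp X alg_psh (mod_psh M) (mod_psh M) (fun U (a : A U) (s : M U) => a *: s)
    mod_resZ.

Section Ops.
Variable U : opens X.

Definition gmod_sec : Type := generated (mod_psh M) U.

HB.instance Definition _ := gen_eqMixin gmod_sec.
HB.instance Definition _ := gen_choiceMixin gmod_sec.

Definition gmod_add (s t : gmod_sec) : gmod_sec := gen_op mod_add_op U s t.
Definition gmod_scale (a : A U) (s : gmod_sec) : gmod_sec :=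
  gen_op mod_scale_op U (@eta X alg_psh U a) s.
Definition gmod_zero : gmod_sec := @eta X (mod_psh M) U (0 : M U).

Let gmod_addA : associative gmod_add.
Proof.
move=> s t u; apply: gen_sec_eq => x Ux /=.
have [V [Vx [s' [t' [u' [-> -> ->]]]]]] :=
  stalkP3 (sval s x Ux) (sval t x Ux) (sval u x Ux).
by rewrite !stalk_opE /= addrA.
Qed.

Let gmod_addC : commutative gmod_add.
Proof.
move=> s t; apply: gen_sec_eq => x Ux /=.
have [V [Vx [s' [t' [-> ->]]]]] := stalkP2 (sval s x Ux) (sval t x Ux).
by rewrite !stalk_opE /= addrC.
Qed.

Let alg_germ (a : A U) x (Ux : U x) (W : opens X)
    (Wx : W x) (h : W `<=` U) :
  @germ X alg_psh U x Ux a = @germ X alg_psh W x Wx (alg_res A h a).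
Proof. by rewrite (germ_res (F := alg_psh) h Ux Wx). Qed.

Lemma gmod_at (s : gmod_sec) x (Ux : U x) :
  exists (W : opens X) (h : W `<=` U) (Wx : W x) (u : M W),
    sval s x Ux = @germ X (mod_psh M) W x Wx u.
Proof.
have [W [Wx [h [u e]]]] := svalP s x Ux; exists W, h, Wx, u.
by rewrite -e; congr (sval s x _); exact: Prop_irrelevance.
Qed.

Lemma gmod_at2 (s t : gmod_sec) x (Ux : U x) :
  exists (W : opens X) (h : W `<=` U) (Wx : W x) (u v : M W),
    sval s x Ux = @germ X (mod_psh M) W x Wx u /\
    sval t x Ux = @germ X (mod_psh M) W x Wx v.
Proof.
have [W [h [Wx [u ->]]]] := gmod_at s Ux.
have [W' [h' [Wx' [u' ->]]]] := gmod_at t Ux.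
have Ix : opensI W W' x by [].
exists (opensI W W'), (subset_trans (@opensIl _ _ _) h), Ix,
  (mod_res (@opensIl _ _ _) u), (mod_res (@opensIr _ _ _) u').
by rewrite (germ_res (F := mod_psh M) _ Wx) (germ_res (F := mod_psh M) _ Wx').
Qed.

Let gmod_add0 : left_id gmod_zero gmod_add.
Proof.
move=> s; apply: gen_sec_eq => x Ux /=.
have [W [h [Wx [u ->]]]] := gmod_at s Ux.
rewrite -(germ_res (F := mod_psh M) h Ux Wx) stalk_opE /= mod_res0.
by rewrite add0r.
Qed.

Let gmod_scaleA a b s : gmod_scale a (gmod_scale b s) = gmod_scale (a * b) s.
Proof.
apply: gen_sec_eq => x Ux /=.
have [W [h [Wx [u ->]]]] := gmod_at s Ux.
rewrite !(alg_germ _ Ux Wx h) !stalk_opE /=.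
by rewrite scalerA rmorphM.
Qed.

Let gmod_scale1 : left_id 1 gmod_scale.
Proof.
move=> s; apply: gen_sec_eq => x Ux /=.
have [W [h [Wx [u ->]]]] := gmod_at s Ux.
by rewrite !(alg_germ _ Ux Wx h) !stalk_opE /= rmorph1 scale1r.
Qed.

Let gmod_scaleDr : right_distributive gmod_scale gmod_add.
Proof.
move=> a s t; apply: gen_sec_eq => x Ux /=.
have [W [h [Wx [u [v [-> ->]]]]]] := gmod_at2 s t Ux.
by rewrite !(alg_germ _ Ux Wx h) !stalk_opE /= scalerDr.
Qed.

Let gmod_scaleDl s : {morph gmod_scale^~ s : a b / a + b >-> gmod_add a b}.
Proof.
move=> a b; apply: gen_sec_eq => x Ux /=.
have [W [h [Wx [u ->]]]] := gmod_at s Ux.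
by rewrite !(alg_germ _ Ux Wx h) !stalk_opE /= rmorphD scalerDl.
Qed.

Let gmod_addN : left_inverse gmod_zero (gmod_scale (-1)) gmod_add.
Proof.
move=> s; apply: gen_sec_eq => x Ux /=.
have [W [h [Wx [u ->]]]] := gmod_at s Ux.
rewrite !(alg_germ _ Ux Wx h) !stalk_opE /= rmorphN1 scaleN1r addNr.
by rewrite -(germ_res (F := mod_psh M) h Ux Wx) /= mod_res0.
Qed.

HB.instance Definition _ :=
  GRing.isZmodule.Build gmod_sec gmod_addA gmod_addC gmod_add0 gmod_addN.

HB.instance Definition _ := GRing.Zmodule_isLmodule.Build (A U) gmod_sec
  gmod_scaleA gmod_scale1 gmod_scaleDr gmod_scaleDl.

End Ops.

Lemma gmod_res_lin (U V : opens X) (h : V `<=` U) (a : A U) (s t : gmod_sec U) :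
  gen_res h (a *: s + t) =
  (alg_res A h a *: (gen_res h s : gmod_sec V) + (gen_res h t : gmod_sec V))
    :> gmod_sec V.
Proof.
apply: gen_sec_eq => x Vx /=.
by rewrite -(germ_res (F := alg_psh) h (h x Vx) Vx).
Qed.

Definition generated_premodule : module_presheaf :=
  @ModulePresheaf (fun U => gmod_sec U : lmodType (A U))
    (fun U V h => gen_res h) gmod_res_lin
    (@gen_res_id X (mod_psh M)) (@gen_res_comp X (mod_psh M)).

Lemma generated_module_sheaf : is_sheaf (mod_psh generated_premodule).
Proof. exact: generated_sheaf. Qed.

Definition generated_module : module_sheaf := ModuleSheaf generated_module_sheaf.

End GeneratedModule.

Section TensorSheaf.
Variables M N : module_presheaf.

Definition ptens_res (U V : opens X) (h : V `<=` U) :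
    tensor (M U) (N U) -> tensor (M V) (N V) :=
  tens_map (mod_res h) (mod_res h).

Lemma ptens_resE (U V : opens X) (h : V `<=` U) (s : seq (M U * N U)) :
  ptens_res h (tens s) = tens [seq (mod_res h p.1, mod_res h p.2) | p <- s].
Proof.
by apply: (tens_mapE (phi := alg_res A h));
  [exact: mod_res_lin|exact: mod_res_lin|rewrite rmorph1].
Qed.

Lemma ptens_res_lin (U V : opens X) (h : V `<=` U) (a : A U) s t :
  ptens_res h (a *: s + t) = alg_res A h a *: ptens_res h s + ptens_res h t.
Proof.
by apply: (tens_map_lin (phi := alg_res A h));
  [exact: mod_res_lin|exact: mod_res_lin|rewrite rmorph1].
Qed.

Lemma ptens_res_id (U : opens X) (h : U `<=` U) s : ptens_res h s = s.
Proof.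
have [t ->] := tensE s; rewrite ptens_resE; congr tens.
by rewrite -[RHS]map_id; apply: eq_map => -[m n] /=; rewrite !mod_res_id.
Qed.

Lemma ptens_res_comp (U V W : opens X) (h : V `<=` U) (h' : W `<=` V)
  (h'' : W `<=` U) s : ptens_res h' (ptens_res h s) = ptens_res h'' s.
Proof.
have [t ->] := tensE s; rewrite !ptens_resE -map_comp; congr tens.
by apply: eq_map => -[m n] /=; rewrite !(mod_res_comp _ _ h'').
Qed.

Definition tensor_presheaf : module_presheaf :=
  @ModulePresheaf (fun U => tensor (M U) (N U) : lmodType (A U))
    ptens_res ptens_res_lin ptens_res_id ptens_res_comp.

Definition tensor_sheaf : module_sheaf := generated_module tensor_presheaf.

Definition otimes (U : opens X) (m : M U) (n : N U) : tensor_sheaf U :=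
  @eta X (mod_psh tensor_presheaf) U (tens [:: (m, n)]).

End TensorSheaf.

Definition mx_res m n (U V : opens X) (h : V `<=` U) (M : 'M[A U]_(m, n)) :
  'M[A V]_(m, n) := map_mx (alg_res A h) M.

Lemma mx_res_lin m n (U V : opens X) (h : V `<=` U) (a : A U) (s t : 'M_(m, n)) :
  mx_res h (a *: s + t) = alg_res A h a *: mx_res h s + mx_res h t.
Proof. by apply/matrixP => i j; rewrite !mxE rmorphD rmorphM. Qed.

Lemma mx_res_id m n (U : opens X) (h : U `<=` U) (s : 'M[A U]_(m, n)) :
  mx_res h s = s.
Proof. by apply/matrixP => i j; rewrite !mxE alg_res_id. Qed.

Lemma mx_res_comp m n (U V W : opens X) (h : V `<=` U) (h' : W `<=` V)
  (h'' : W `<=` U) (s : 'M[A U]_(m, n)) : mx_res h' (mx_res h s) = mx_res h'' s.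
Proof. by apply/matrixP => i j; rewrite !mxE (alg_res_comp _ _ h''). Qed.

Definition mx_premodule m n : module_presheaf :=
  @ModulePresheaf (fun U => 'M[A U]_(m, n) : lmodType (A U))
    (@mx_res m n) (@mx_res_lin m n) (@mx_res_id m n) (@mx_res_comp m n).

Lemma mx_is_sheaf m n : is_sheaf (mod_psh (mx_premodule m n)).
Proof.
move=> U I V hV cV s cs.
have H (ij : 'I_m * 'I_n) : exists! t : A U,
    forall k, alg_res A (hV k) t = s k ij.1 ij.2.
  apply: (alg_is_sheaf hV cV (s := fun k => s k ij.1 ij.2)) => k l.
  by have /matrixP /(_ ij.1 ij.2) := cs k l; rewrite !mxE.
pose t : 'M[A U]_(m, n) := \matrix_(i, j) projT1 (cid (H (i, j))).
exists t; split=> [k|t' e].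
  apply/matrixP => i j; rewrite !mxE; case: cid => u [/= eu _]; exact: eu.
apply/matrixP => i j; rewrite !mxE; case: cid => u [/= _]; apply => k.
by rewrite -e !mxE.
Qed.

Definition mx_sheaf m n : module_sheaf := ModuleSheaf (@mx_is_sheaf m n).

Definition free_sheaf n : module_sheaf := mx_sheaf n 1.

Definition std_basis n (U : opens X) (j : 'I_n) : free_sheaf n U :=
  (delta_mx j 0 : 'cV[A U]_n).

Section GeneralLinear.
Variable n : nat.

Record GL (U : opens X) := MkGL {
  gl_mx :> 'M[A U]_n;
  gl_inv_mx : 'M[A U]_n;
  gl_mulmxV : gl_mx *m gl_inv_mx = 1%:M;
  gl_mulVmx : gl_inv_mx *m gl_mx = 1%:M }.

Lemma gl_eq U (g h : GL U) : gl_mx g = gl_mx h -> g = h.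
Proof.
case: g h => [g g' gg' g'g] [h h' hh' h'h] /= e; subst h.
have e : g' = h' by rewrite -[g']mulmx1 -hh' mulmxA g'g mul1mx.
by subst h'; congr MkGL; exact: Prop_irrelevance.
Qed.

Definition gl_one U : GL U := MkGL (mulmx1 1%:M) (mulmx1 1%:M).

Definition gl_inv U (g : GL U) : GL U := MkGL (gl_mulVmx g) (gl_mulmxV g).

Lemma gl_mul_subproof U (g h : GL U) :
  (g *m h) *m (gl_inv_mx h *m gl_inv_mx g) = 1%:M.
Proof. by rewrite mulmxA -(mulmxA (gl_mx g)) gl_mulmxV mulmx1 gl_mulmxV. Qed.

Definition gl_mul U (g h : GL U) : GL U :=
  MkGL (gl_mul_subproof g h) (gl_mul_subproof (gl_inv h) (gl_inv g)).

Lemma gl_res_subproof (U V : opens X) (h : V `<=` U) (g : GL U) :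
  mx_res h (gl_mx g) *m mx_res h (gl_inv_mx g) = 1%:M.
Proof. by rewrite -map_mxM gl_mulmxV map_mx1. Qed.

Definition gl_res (U V : opens X) (h : V `<=` U) (g : GL U) : GL V :=
  MkGL (gl_res_subproof h g) (gl_res_subproof h (gl_inv g)).

Lemma gl_res_id (U : opens X) (h : U `<=` U) g : gl_res h g = g.
Proof. by apply: gl_eq; exact: mx_res_id. Qed.

Lemma gl_res_comp (U V W : opens X) (h : V `<=` U) (h' : W `<=` V)
  (h'' : W `<=` U) g : gl_res h' (gl_res h g) = gl_res h'' g.
Proof. by apply: gl_eq; exact: mx_res_comp. Qed.

Definition gl_sheaf : presheaf X := Presheaf gl_res_id gl_res_comp.

Lemma gl_is_sheaf : is_sheaf gl_sheaf.
Proof.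
move=> U I V hV cV s cs.
have [|g [ge gu]] := @mx_is_sheaf n n U I V hV cV (fun i => gl_mx (s i)).
  by move=> i j; exact: (congr1 (@gl_mx _) (cs i j)).
have [|g' [ge' _]] := @mx_is_sheaf n n U I V hV cV (fun i => gl_inv_mx (s i)).
  by move=> i j; exact: (congr1 (@gl_inv_mx _) (cs i j)).
have gg' : (g : 'M_n) *m g' = 1%:M.
  apply: (sheaf_sep (@mx_is_sheaf n n) (hV := hV) cV) => i /=.
  by rewrite /mx_res map_mxM map_mx1 (ge i : map_mx _ _ = _)
    (ge' i : map_mx _ _ = _) gl_mulmxV.
have g'g : (g' : 'M_n) *m g = 1%:M.
  apply: (sheaf_sep (@mx_is_sheaf n n) (hV := hV) cV) => i /=.
  by rewrite /mx_res map_mxM map_mx1 (ge i : map_mx _ _ = _)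
    (ge' i : map_mx _ _ = _) gl_mulVmx.
exists (MkGL gg' g'g); split=> [i|h e]; first by apply: gl_eq; exact: ge.
by apply: gl_eq; apply: gu => i; rewrite -e.
Qed.

Record principal_sheaf := PrincipalSheaf {
  ps_psh :> presheaf X;
  ps_is_sheaf : is_sheaf ps_psh;
  ps_act : forall U, ps_psh U -> GL U -> ps_psh U;
  ps_act_res : forall (U V : opens X) (h : V `<=` U) s g,
    pres h (ps_act s g) = ps_act (pres h s) (gl_res h g);
  ps_act1 : forall U (s : ps_psh U), ps_act s (gl_one U) = s;
  ps_actM : forall U (s : ps_psh U) g g',
    ps_act s (gl_mul g g') = ps_act (ps_act s g) g';
  ps_local : exists (I : Type) (U : I -> opens X), covers U [set: X] /\
    forall i, exists Phi : forall V : opens X, V `<=` U i -> ps_psh V -> GL V,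
    [/\ forall (V W : opens X) (h : V `<=` U i) (h' : W `<=` U i)
          (k : W `<=` V) s, Phi W h' (pres k s) = gl_res k (Phi V h s),
        forall (V : opens X) (h : V `<=` U i) s g,
          Phi V h (ps_act s g) = gl_mul (Phi V h s) g
      & forall (V : opens X) (h : V `<=` U i), bijective (Phi V h)] }.

Lemma ps_act_free (P : principal_sheaf) U (s : P U) (g h : GL U) :
  ps_act s g = ps_act s h -> g = h.
Proof.
move=> e; apply: (sheaf_sep_loc gl_is_sheaf) => x Ux.
have [I [V [cV /= H]]] := ps_local P; have [i Vx] := cV x Logic.I.
have [Phi [_ Phig _]] := H i.
exists (opensI U (V i)), (@opensIl _ _ _); split=> //=.
have := congr1 (fun t => Phi _ (@opensIr _ _ _) (pres (@opensIl _ U (V i)) t)) e.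
rewrite !ps_act_res !Phig => /(congr1 (gl_mul (gl_inv (Phi _ (@opensIr _ _ _)
  (pres (@opensIl _ U (V i)) s))))) /(congr1 (@gl_mx _)) /=.
by rewrite !mulmxA gl_mulVmx !mul1mx => e'; exact: gl_eq.
Qed.

(* The sheaf associated with P by the identity of GL(n, A), which acts on A^n
   by multiplication of column vectors. *)
Section Associated.
Variable P : principal_sheaf.

Definition assoc_rel (V : opens X) (p q : P V * 'cV[A V]_n) : Prop :=
  exists! g : GL V, q.1 = ps_act p.1 g /\ q.2 = gl_inv g *m p.2.

Lemma assoc_relP V p q : @assoc_rel V p q <->
  exists g : GL V, q.1 = ps_act p.1 g /\ q.2 = gl_inv g *m p.2.
Proof.
split=> [[g [h _]]|[g [h1 h2]]]; first by exists g.
by exists g; split=> // g' [e _]; apply: (@ps_act_free _ _ p.1); rewrite -h1.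
Qed.

Lemma assoc_rel_equiv V : RelationClasses.Equivalence (@assoc_rel V).
Proof.
split=> [p|p q|p q r].
- apply/assoc_relP; exists (gl_one V).
  by rewrite ps_act1 /= mul1mx.
- move=> /assoc_relP [g [e1 e2]]; apply/assoc_relP; exists (gl_inv g).
  rewrite e1 e2 /= mulmxA gl_mulmxV mul1mx -ps_actM; split=> //.
  rewrite -[LHS]ps_act1; congr ps_act; apply: gl_eq.
  by rewrite /= gl_mulmxV.
- move=> /assoc_relP [g [e1 e2]] /assoc_relP [g' [e1' e2']].
  apply/assoc_relP; exists (gl_mul g g').
  by rewrite e1' e2' e1 e2 ps_actM /= mulmxA.
Qed.

Definition assoc_class V (s : P V) (a : 'cV[A V]_n) : quotient (@assoc_rel V) :=
  qpi _ (s, a).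

Definition assoc_res (U V : opens X) (h : V `<=` U)
    (c : quotient (@assoc_rel U)) : quotient (@assoc_rel V) :=
  let p := qrepr c in assoc_class (pres h p.1) (mx_res h p.2).

Lemma assoc_resE (U V : opens X) (h : V `<=` U) (s : P U) a :
  assoc_res h (assoc_class s a) = assoc_class (pres h s) (mx_res h a).
Proof.
apply/(qpiP (assoc_rel_equiv V)).
have /assoc_relP [g [/= e1 e2]] := qrepr_pi (assoc_rel_equiv U) (s, a).
apply/assoc_relP; exists (gl_res h g); split=> /=.
  by rewrite -ps_act_res [in LHS]e1.
by rewrite [in LHS]e2 -map_mxM.
Qed.

Lemma assoc_classP V (c : quotient (@assoc_rel V)) :
  exists s a, c = assoc_class s a.
Proof.
by exists (qrepr c).1, (qrepr c).2; rewrite /assoc_class -surjective_pairing qreprK.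
Qed.

Lemma assoc_res_id (U : opens X) (h : U `<=` U) c : assoc_res h c = c.
Proof.
by have [s [a ->]] := assoc_classP c; rewrite assoc_resE pres_id mx_res_id.
Qed.

Lemma assoc_res_comp (U V W : opens X) (h : V `<=` U) (h' : W `<=` V)
  (h'' : W `<=` U) c : assoc_res h' (assoc_res h c) = assoc_res h'' c.
Proof.
have [s [a ->]] := assoc_classP c.
by rewrite !assoc_resE (pres_comp _ _ h'') (mx_res_comp _ _ h'').
Qed.

Definition assoc_presheaf : presheaf X := Presheaf assoc_res_id assoc_res_comp.

Definition associated_sheaf : presheaf X := generated assoc_presheaf.

End Associated.
End GeneralLinear.

Arguments gl_one {n U}.

Record module_structure (F : presheaf X) := ModuleStructure {
  mst_zero : forall U, F U;
  mst_opp : forall U, F U -> F U;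
  mst_add : forall U, F U -> F U -> F U;
  mst_scale : forall U, A U -> F U -> F U;
  mst_addA : forall U, associative (@mst_add U);
  mst_addC : forall U, commutative (@mst_add U);
  mst_add0 : forall U, left_id (mst_zero U) (@mst_add U);
  mst_addN : forall U, left_inverse (mst_zero U) (@mst_opp U) (@mst_add U);
  mst_scaleA : forall U a b (s : F U),
    mst_scale a (mst_scale b s) = mst_scale (a * b) s;
  mst_scale1 : forall U, left_id 1 (@mst_scale U);
  mst_scaleDr : forall U, right_distributive (@mst_scale U) (@mst_add U);
  mst_scaleDl : forall U (s : F U),
    {morph (@mst_scale U)^~ s : a b / a + b >-> mst_add a b};
  mst_res : forall (U V : opens X) (h : V `<=` U) (a : A U) (s t : F U),
    pres h (mst_add (mst_scale a s) t) =
    mst_add (mst_scale (alg_res A h a) (pres h s)) (pres h t) }.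

Section ModuleOf.
Variables (F : presheaf X) (S : module_structure F).

Section Ops.
Variable U : opens X.
Definition mst_sec : Type := (fun _ : module_structure F => F U) S.
HB.instance Definition _ := gen_eqMixin mst_sec.
HB.instance Definition _ := gen_choiceMixin mst_sec.
HB.instance Definition _ := GRing.isZmodule.Build mst_sec
  (@mst_addA F S U) (@mst_addC F S U) (@mst_add0 F S U) (@mst_addN F S U).
HB.instance Definition _ := GRing.Zmodule_isLmodule.Build (A U) mst_sec
  (@mst_scaleA F S U) (@mst_scale1 F S U) (@mst_scaleDr F S U) (@mst_scaleDl F S U).
End Ops.

Definition module_of : module_presheaf :=
  @ModulePresheaf (fun U => mst_sec U : lmodType (A U))
    (fun U V h => @pres X F U V h) (@mst_res F S) (@pres_id X F) (@pres_comp X F).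

End ModuleOf.

Record local_frames (n : nat) (E : module_sheaf) := LocalFrames {
  lf_index : Type;
  lf_open : lf_index -> opens X;
  lf_cover : covers lf_open [set: X];
  lf_psi : forall i, iso_on (lf_open i) (free_sheaf n) E }.

Section Frames.
Variables (n : nat) (E : module_sheaf) (L : local_frames n E).

(* The presheaf of frames is indexed by the basis of the open sets that are
   contained in some U_i; it is extended by the empty set to the other opens,
   which does not change its germs. *)
Record frame (V : opens X) := Frame {
  frame_iso : iso_on V (free_sheaf n) E;
  frame_basis : exists i : lf_index L, V `<=` lf_open i }.

Lemma frame_eq V (f g : frame V) : frame_iso f = frame_iso g -> f = g.
Proof.
by case: f g => [f p] [g q] /= e; subst g; congr Frame; exact: Prop_irrelevance.
Qed.

Lemma frame_res_subproof (U V : opens X) (h : V `<=` U) (f : frame U) :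
  exists i : lf_index L, V `<=` lf_open i.
Proof. by have [i hi] := frame_basis f; exists i; exact: subset_trans hi. Qed.

Definition frame_res (U V : opens X) (h : V `<=` U) (f : frame U) : frame V :=
  Frame (iso_restrict h (frame_iso f)) (frame_res_subproof h f).

Lemma frame_res_id (U : opens X) (h : U `<=` U) f : frame_res h f = f.
Proof.
apply: frame_eq; apply: iso_eq => W k s /=.
by rewrite (Prop_irrelevance (subset_trans k h) k).
Qed.

Lemma frame_res_comp (U V W : opens X) (h : V `<=` U) (h' : W `<=` V)
  (h'' : W `<=` U) f : frame_res h' (frame_res h f) = frame_res h'' f.
Proof.
apply: frame_eq; apply: iso_eq => Z k s /=.
by rewrite (Prop_irrelevance (subset_trans _ _) (subset_trans k h'')).
Qed.

Definition frame_presheaf : presheaf X := Presheaf frame_res_id frame_res_comp.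

(* The composite of f with the automorphism of A^n|_V given by g. *)
Section FrameMul.
Variables (V : opens X) (f : frame V) (g : GL n V).

Definition frame_mul_app (W : opens X) (h : W `<=` V) (a : 'cV[A W]_n) : E W :=
  iso_app (frame_iso f) h ((gl_res h g : 'M_n) *m a : free_sheaf n W).

Lemma frame_mul_lin (W : opens X) (h : W `<=` V) (a : A W) (s t : 'cV[A W]_n) :
  frame_mul_app h (a *: s + t) = a *: frame_mul_app h s + frame_mul_app h t.
Proof. by rewrite /frame_mul_app mulmxDr -scalemxAr; exact: iso_lin. Qed.

Lemma frame_mul_res (W W' : opens X) (h : W `<=` V) (h' : W' `<=` V)
    (k : W' `<=` W) (s : 'cV[A W]_n) :
  frame_mul_app h' (mx_res k s) = mod_res k (frame_mul_app h s).
Proof.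
rewrite /frame_mul_app -(iso_res _ h h' k); congr iso_app.
rewrite /= /mx_res map_mxM; congr (_ *m _).
exact: (esym (mx_res_comp h k h' g)).
Qed.

Lemma frame_mul_bij (W : opens X) (h : W `<=` V) : bijective (frame_mul_app h).
Proof.
have [k fk kf] := iso_bij (frame_iso f) h.
exists (fun e => gl_inv (gl_res h g) *m (k e : 'cV[A W]_n)) => s.
  by rewrite /frame_mul_app fk mulmxA gl_mulVmx mul1mx.
by rewrite /frame_mul_app mulmxA gl_mulmxV mul1mx kf.
Qed.

Definition frame_mul : frame V :=
  Frame (@IsoOn V (free_sheaf n) E frame_mul_app frame_mul_lin frame_mul_res
    frame_mul_bij) (frame_basis f).

End FrameMul.

Lemma frame_mul_op_res (U V : opens X) (h : V `<=` U) (f : frame U) (g : GL n U) :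
  frame_res h (frame_mul f g) = frame_mul (frame_res h f) (gl_res h g).
Proof.
apply: frame_eq; apply: iso_eq => W k s /=; rewrite /frame_mul_app.
by congr iso_app; congr (_ *m _); exact: (esym (mx_res_comp h k (subset_trans k h) g)).
Qed.

Definition frame_op : psh_op frame_presheaf (gl_sheaf n) frame_presheaf :=
  @PshOp X frame_presheaf (gl_sheaf n) frame_presheaf frame_mul frame_mul_op_res.

Definition frames : presheaf X := generated frame_presheaf.

Definition frames_act (U : opens X) (s : frames U) (g : GL n U) : frames U :=
  gen_op frame_op U s (@eta X (gl_sheaf n) U g).

Lemma frames_act_eta (U : opens X) (f : frame U) (g : GL n U) :
  frames_act (@eta X frame_presheaf U f) g = @eta X frame_presheaf U (frame_mul f g).
Proof. exact: gen_op_eta. Qed.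

Lemma frames_act_res (U V : opens X) (h : V `<=` U) (s : frames U) (g : GL n U) :
  pres h (frames_act s g) = frames_act (pres h s) (gl_res h g).
Proof.
rewrite [LHS]pop_res; congr (gen_op _ _ _ _).
by rewrite -(pmap_res (@eta X (gl_sheaf n))).
Qed.

Lemma frames_act1 (U : opens X) (s : frames U) : frames_act s gl_one = s.
Proof.
apply: (sheaf_sep_loc (@generated_sheaf _ _)) => x Ux.
have [V [Vx [h [f e]]]] := generatedP s Ux; exists V, h; split=> //.
rewrite frames_act_res e frames_act_eta; congr (eta _ _).
apply: frame_eq; apply: iso_eq => W k a /=; rewrite /frame_mul_app /=.
by rewrite /mx_res !map_mx1 mul1mx.
Qed.

Lemma frames_actM (U : opens X) (s : frames U) (g g' : GL n U) :
  frames_act s (gl_mul g g') = frames_act (frames_act s g) g'.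
Proof.
apply: (sheaf_sep_loc (@generated_sheaf _ _)) => x Ux.
have [V [Vx [h [f e]]]] := generatedP s Ux; exists V, h; split=> //.
rewrite !frames_act_res e !frames_act_eta; congr (eta _ _).
apply: frame_eq; apply: iso_eq => W k a /=; rewrite /frame_mul_app /=.
by rewrite /frame_mul_app /= /mx_res !map_mxM mulmxA.
Qed.

Definition natural_frame (i : lf_index L) : frame (lf_open i) :=
  Frame (lf_psi i) (ex_intro _ i (@subset_refl _ _)).

Definition natural_section (i : lf_index L) : frames (lf_open i) :=
  @eta X frame_presheaf _ (natural_frame i).

Section Chart.
Variables (i : lf_index L) (V : opens X) (hV : V `<=` lf_open i).

Lemma chart_inj (g g' : GL n V) :
  frames_act (pres hV (natural_section i)) g =
  frames_act (pres hV (natural_section i)) g' -> g = g'.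
Proof.
rewrite -(pmap_res (@eta X frame_presheaf)) !frames_act_eta => /eta_eqP H.
apply: (sheaf_sep_loc (@gl_is_sheaf n)) => x Vx.
have [W [h [Wx e]]] := H x Vx; exists W, h; split=> //=.
apply: gl_eq; apply/matrixP => k l.
have := congr1 (fun f => iso_app (frame_iso f) (@subset_refl _ W)
                  (std_basis W l)) e.
rewrite /= /frame_mul_app /= => /(bij_inj (iso_bij _ _)).
rewrite (Prop_irrelevance (subset_trans _ _) h) -!colE => /matrixP /(_ k 0).
by rewrite !mxE.
Qed.

Lemma frame_chart_surj (f : frame V) :
  exists g, f = frame_mul (frame_res hV (natural_frame i)) g.
Proof.
pose p := iso_restrict hV (lf_psi i); pose q := frame_iso f.
have inv (r : iso_on V (free_sheaf n) E) : exists r' : forall W : opens X, W `<=` V -> E W -> 'cV[A W]_n,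
   (forall W h, cancel (r' W h) (iso_app r h)) /\ (forall W h, cancel (iso_app r h) (r' W h)).
  have H (W : opens X) (h : W `<=` V) : exists r' : E W -> 'cV[A W]_n,
      cancel r' (iso_app r h) /\ cancel (iso_app r h) r'.
    by have [r' e e'] := iso_bij r h; exists r'.
  by exists (fun W h => projT1 (cid (H W h))); split=> W h; case: cid => ? [].
have mat (r s : iso_on V (free_sheaf n) E) : exists m : 'M[A V]_n,
    forall (W : opens X) (h : W `<=` V) (a : 'cV[A W]_n),
      iso_app s h a = iso_app r h (mx_res h m *m a : 'cV[A W]_n).
  have [r' [r'K rK]] := inv r.
  have injr W h : injective (@iso_app _ _ _ r W h) by exact: can_inj (rK W h).
  exists (\matrix_(k, l) r' V (@subset_refl _ _)
    (iso_app s (@subset_refl _ _) (std_basis V l)) k 0) => W h a.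
  set m := \matrix_(k, l) _.
  have sumr (t : iso_on V (free_sheaf n) E) (b : 'I_n -> A W) (u : 'I_n -> 'cV[A W]_n) :
      iso_app t h (\sum_l b l *: u l : 'cV[A W]_n) = \sum_l b l *: iso_app t h (u l).
    have t0 : iso_app t h 0 = 0.
      by apply: (addrI (iso_app t h 0)); rewrite addr0 -[X in X + _]scale1r
        -iso_lin scale1r !addr0.
    have tD : {morph (iso_app t h : 'cV[A W]_n -> E W) : x y / x + y}.
      by move=> x y; have := iso_lin t h 1 x y; rewrite !scale1r.
    rewrite (big_morph _ tD t0); apply: eq_bigr => l _.
    by have := iso_lin t h (b l) (u l) 0; rewrite !addr0 t0 addr0.
  have aE : a = \sum_l a l 0 *: (delta_mx l 0 : 'cV[A W]_n).
    apply/matrixP => k l; rewrite summxE (bigD1 k) //= big1 => [|k' nk].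
      by rewrite !mxE eqxx ord1 eqxx mulr1 addr0.
    by rewrite !mxE eq_sym (negPf nk) mulr0.
  have maE : mx_res h m *m a = \sum_l a l 0 *: col l (mx_res h m).
    apply/matrixP => k l; rewrite summxE !mxE; apply: eq_bigr => k' _.
    by rewrite !mxE ord1 mulrC.
  rewrite maE [in LHS]aE !sumr; apply: eq_bigr => l _; congr (_ *: _).
  have -> : col l (mx_res h m) = mx_res h (col l m).
    by apply/matrixP => k k'; rewrite !mxE.
  have -> : col l m = r' V (@subset_refl _ _) (iso_app s (@subset_refl _ _) (std_basis V l)).
    by apply/matrixP => k k'; rewrite !mxE ord1.
  have /= -> := iso_res r (@subset_refl _ _) h h (r' V (@subset_refl _ _) (iso_app s (@subset_refl _ _) (std_basis V l))).
  rewrite r'K -(iso_res s (@subset_refl _ _) h h); congr iso_app.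
  by apply/matrixP => k k'; rewrite !mxE rmorph_nat.
have [m mE] := mat p q; have [m' m'E] := mat q p.
have uniq (r : iso_on V (free_sheaf n) E) (u : 'M[A V]_n) :
   (forall a : 'cV[A V]_n, iso_app r (@subset_refl _ V) a =
      iso_app r (@subset_refl _ V) (u *m a : 'cV[A V]_n)) -> u = 1%:M.
  move=> e; apply/matrixP => k l.
  have /(bij_inj (iso_bij _ _)) := e (delta_mx l 0); rewrite -colE => /matrixP /(_ k 0).
  by rewrite !mxE eqxx andbT => <-.
have mm' : m *m m' = 1%:M.
  apply: (uniq p) => a; rewrite m'E mE !mx_res_id; by rewrite mulmxA.
have m'm : m' *m m = 1%:M.
  by apply: (uniq q) => a; rewrite mE m'E !mx_res_id mulmxA.
exists (MkGL mm' m'm); apply: frame_eq; apply: iso_eq => W h a.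
exact: mE.
Qed.

End Chart.

Lemma chart_surj (i : lf_index L) (V : opens X) (hV : V `<=` lf_open i) (s : frames V) :
  exists g : GL n V, s = frames_act (pres hV (natural_section i)) g.
Proof.
pose P (W : opens X) := exists (h : W `<=` V) (g : GL n W),
  pres h s = frames_act (pres h (pres hV (natural_section i))) g.
pose I := {W : opens X | P W}.
have hI (j : I) : sval j `<=` V by have [] := svalP j.
have gI (j : I) : exists g : GL n (sval j),
    pres (hI j) s = frames_act (pres (hI j) (pres hV (natural_section i))) g.
  by have [h [g e]] := svalP j; exists g; rewrite (Prop_irrelevance (hI j) h).
have cI : covers (fun j : I => sval j) V.
  move=> x Vx; have [W [Wx [h [f e]]]] := generatedP s Vx.
  have [g fg] := frame_chart_surj (subset_trans h hV) f.
  have HW : P W.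
    exists h, g; rewrite e (pres_comp _ _ (subset_trans h hV)).
    by rewrite -(pmap_res (@eta X frame_presheaf)) frames_act_eta fg.
  by exists (exist _ W HW).
have [|g [eg _]] := gl_is_sheaf hI cI (s := fun j => projT1 (cid (gI j))).
  move=> j k; case: cid => g eg; case: cid => g' eg'.
  set W := opensI _ _; set l := @opensIl _ _ _; set r := @opensIr _ _ _.
  have lr : subset_trans l (hI j) = subset_trans r (hI k) by exact: Prop_irrelevance.
  apply: (@chart_inj i W (subset_trans (subset_trans l (hI j)) hV)).
  have := congr1 (@pres X frames _ _ l) eg; have := congr1 (@pres X frames _ _ r) eg'.
  rewrite !frames_act_res !(pres_comp _ _ (subset_trans l (hI j))) => ->.
  by rewrite !(pres_comp _ _ (subset_trans (subset_trans l (hI j)) hV)).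
exists g; apply: (sheaf_sep (@generated_sheaf _ _) (hV := hI) cI) => j.
rewrite frames_act_res; have /= -> := eg j.
by case: cid.
Qed.

Lemma frames_local : exists (I : Type) (U : I -> opens X), covers U [set: X] /\
  forall i, exists Phi : forall V : opens X, V `<=` U i -> frames V -> GL n V,
  [/\ forall (V W : opens X) (h : V `<=` U i) (h' : W `<=` U i)
        (k : W `<=` V) s, Phi W h' (pres k s) = gl_res k (Phi V h s),
      forall (V : opens X) (h : V `<=` U i) s g,
        Phi V h (frames_act s g) = gl_mul (Phi V h s) g
    & forall (V : opens X) (h : V `<=` U i), bijective (Phi V h)].
Proof.
exists (lf_index L), (@lf_open n E L); split; first exact: lf_cover.
move=> i; exists (fun V h s => projT1 (cid (chart_surj h s))).
have PhiE (V : opens X) (h : V `<=` lf_open i) s :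
    s = frames_act (pres h (natural_section i)) (projT1 (cid (chart_surj h s))).
  by case: cid.
split=> [V W h h' k s|V h s g|V h].
- apply: (@chart_inj i W h'); rewrite -PhiE -(pres_comp h k) -frames_act_res.
  by rewrite -PhiE.
- by apply: (@chart_inj i V h); rewrite -PhiE frames_actM -PhiE.
- exists (frames_act (pres h (natural_section i))) => [s|g]; first by rewrite -PhiE.
  by apply: (@chart_inj i V h); rewrite -PhiE.
Qed.

Definition frame_sheaf : principal_sheaf n :=
  @PrincipalSheaf n frames (@generated_sheaf X frame_presheaf)
    frames_act frames_act_res frames_act1 frames_actM frames_local.

Definition Psi (i : lf_index L) (V : opens X) (h : V `<=` lf_open i)
    (a : 'cV[A V]_n) : associated_sheaf frame_sheaf V :=
  @eta X (assoc_presheaf frame_sheaf) V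
    (@assoc_class n frame_sheaf V (pres h (natural_section i)) a).

End Frames.

Record differential_triad := DifferentialTriad {
  dt_forms :> module_sheaf;
  dt_d : forall U : opens X, A U -> dt_forms U;
  dt_res : forall (U V : opens X) (h : V `<=` U) (a : A U),
    dt_d (alg_res A h a) = mod_res h (dt_d a);
  dt_lin : forall (U : opens X) (k : K) (s t : A U),
    dt_d (alg_const A U k * s + t) = alg_const A U k *: dt_d s + dt_d t;
  dt_leibniz : forall (U : opens X) (s t : A U),
    dt_d (s * t) = s *: dt_d t + t *: dt_d s }.

Section Connections.
Variable Omega : differential_triad.

Section Principal.
Variable n : nat.

Definition mx_forms : module_sheaf := tensor_sheaf Omega (mx_sheaf n n).

(* The identification of M_n(Omega(U)) with (Omega ⊗_A M_n(A))(U). *)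
Definition mx_form (U : opens X) (theta : 'M[Omega U]_n) : mx_forms U :=
  \sum_(i < n) \sum_(j < n)
    otimes (theta i j) (delta_mx i j : mx_sheaf n n U).

Definition Ad (U : opens X) (g : GL n U) (u : mx_sheaf n n U) : mx_sheaf n n U :=
  (g : 'M_n) *m (u : 'M_n) *m (gl_inv g : 'M_n).

Lemma Ad_lin (U : opens X) (g : GL n U) (a : A U) (u v : mx_sheaf n n U) :
  Ad g (a *: u + v) = a *: Ad g u + Ad g v.
Proof. by rewrite /Ad mulmxDr mulmxDl -scalemxAr -scalemxAl. Qed.

(* Ad(g).(theta ⊗ u) = theta ⊗ Ad(g)(u) *)
Definition pAd (U : opens X) (g : GL n U) :
    tensor (Omega U) (mx_sheaf n n U) -> tensor (Omega U) (mx_sheaf n n U) :=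
  tens_map id (Ad g).

Lemma pAdE (U : opens X) (g : GL n U) (s : seq (Omega U * mx_sheaf n n U)) :
  pAd g (tens s) = tens [seq (p.1, Ad g p.2) | p <- s].
Proof. by apply: (tens_mapE (phi := id)) => // a u v; exact: Ad_lin. Qed.

Lemma pAd_res (U V : opens X) (h : V `<=` U) (g : GL n U) c :
  ptens_res h (pAd g c) = pAd (gl_res h g) (ptens_res h c).
Proof.
have [s ->] := tensE c; rewrite pAdE !ptens_resE pAdE -!map_comp; congr tens.
by apply: eq_map => p /=; rewrite /Ad /= /mx_res !map_mxM.
Qed.

Definition Ad_op : psh_op (gl_sheaf n)
    (mod_psh (tensor_presheaf Omega (mx_sheaf n n)))
    (mod_psh (tensor_presheaf Omega (mx_sheaf n n))) :=
  @PshOp X (gl_sheaf n) (mod_psh (tensor_presheaf Omega (mx_sheaf n n)))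
    (mod_psh (tensor_presheaf Omega (mx_sheaf n n))) pAd pAd_res.

Definition Ad_act (U : opens X) (g : GL n U) (w : mx_forms U) : mx_forms U :=
  gen_op Ad_op U (@eta X (gl_sheaf n) U g) w.

Lemma Ad_act_otimes (U : opens X) (g : GL n U) (theta : Omega U)
    (u : mx_sheaf n n U) : Ad_act g (otimes theta u) = otimes theta (Ad g u).
Proof. by rewrite /Ad_act [LHS]gen_op_eta /= pAdE. Qed.

(* g^-1 . (d g_ij), transported along mx_form *)
Definition maurer_cartan (U : opens X) (g : GL n U) : mx_forms U :=
  mx_form (\matrix_(i, j) \sum_k gl_inv g i k *: dt_d Omega (g k j)).

Record principal_connection (P : principal_sheaf n) := PrincipalConnection {
  pc_map :> psh_map P (mod_psh mx_forms);
  pc_act : forall (U : opens X) (s : P U) (g : GL n U),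
    pc_map U (ps_act s g) =
      (Ad_act (gl_inv g) (pc_map U s) + maurer_cartan g : mx_forms U) }.

End Principal.

Record linear_connection (E : module_sheaf) := LinearConnection {
  lc_map :> psh_map (mod_psh E) (mod_psh (tensor_sheaf E Omega));
  lc_lin : forall (U : opens X) (k : K) (s t : E U),
    lc_map U (alg_const A U k *: s + t) =
      (alg_const A U k *: (lc_map U s : tensor_sheaf E Omega U) + lc_map U t
        : tensor_sheaf E Omega U);
  lc_leibniz : forall (U : opens X) (a : A U) (s : E U),
    lc_map U (a *: s) =
      (a *: (lc_map U s : tensor_sheaf E Omega U) + otimes s (dt_d Omega a)
        : tensor_sheaf E Omega U) }.

Section Correspondence.
Variables (n : nat) (E : module_sheaf) (L : local_frames n E).

Definition basis_section (i : lf_index L) (j : 'I_n) : E (lf_open i) :=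
  iso_app (lf_psi i) (@subset_refl _ _) (std_basis (lf_open i) j).

(* theta is the matrix theta_i of nabla over U_i; it is unique, since the basis
   sections identify E ⊗ Omega with Omega^n over U_i. *)
Definition local_form_of (nabla : linear_connection E) (i : lf_index L)
    (theta : 'M[Omega (lf_open i)]_n) : Prop :=
  forall j, nabla _ (basis_section i j) =
    \sum_(k < n) otimes (basis_section i k) (theta k j)
      :> tensor_sheaf E Omega (lf_open i).

Definition local_forms_agree (nabla : linear_connection E)
    (D : principal_connection (frame_sheaf L)) : Prop :=
  forall i : lf_index L, exists theta : 'M[Omega (lf_open i)]_n,
    local_form_of nabla theta /\ D _ (natural_section i) = mx_form theta.

End Correspondence.
End Connections.
End Modules.
End Sheaves.

Arguments scalars R k : clear implicits.

(* Main.v *)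
From HB Require Import structures.
From mathcomp Require Import all_boot all_order all_algebra.
From mathcomp Require Import boolp classical_sets reals topology_structure.
Require Import Defs.

Set Implicit Arguments.
Unset Strict Implicit.
Unset Printing Implicit Defensive.

Import GRing.Theory.
Local Open Scope classical_set_scope.
Local Open Scope ring_scope.

(** Everything rests on working with all local frames, not only with the natural
    sections. A frame f over V is an isomorphism of A^n with E over V; two
    frames over the same V differ by a unique g in GL(n, A(V))
    ([frame_transition] gives its existence).

    The associated sheaf. A class [f, a] is sent to the section f(a) of E. If
    f' = f.g, then [f', a'] = [f, g a'] and f'(a') = f(g a'), so that two
    classes agree exactly when their images do; both sheaves are locally of
    this form, hence the rule extends to an isomorphism of sheaves of sets
    ([assoc_iso]). A module structure makes every Psi linear exactly when it
    makes this isomorphism linear ([Psi_linearE]), so the structure exists and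
    is unique by transport from E.

    Connections. In a frame f, every section of E ⊗ Omega over V is
    f ⊗ w = sum_k f_k ⊗ w_k for a unique column w of forms, and every section
    of Omega ⊗ M_n(A) comes from a unique matrix of forms ([iso_tens_bij],
    [mx_form_bij]): the presheaves of tensor products concerned have a free
    factor, so they are already sheaves over V. Hence nabla has in f a unique
    matrix t, with nabla(f(a)) = f ⊗ (t a + da), and D(f) is the image of a
    unique matrix of forms. The correspondence is: these two matrices agree for
    every f. Given one side, this rule defines the other, because both matrices
    obey the same law under a change of frame,
    t.g = g^-1 t g + g^-1 dg ([conn_matrix_gauge], [principal_gauge]): for nabla
    this is the Leibniz rule, for D it is the definition of a connection.
    Since every frame below U_i is a multiple of the natural section, the
    matrices agree for all frames as soon as the local connection forms do
    ([local_forms_agreeE]).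

    All the sheaf morphisms are defined in the same way: by a relation between
    sections that is stable under restriction, single-valued and locally total
    ([psh_map_of_rel]). *)


(** * Maps and sheaf morphisms defined by relations *)

Lemma bijection_of_rel (S T : Type) (r : S -> T -> Prop) :
  (forall x, exists y, r x y) -> (forall y, exists x, r x y) ->
  (forall x y y', r x y -> r x y' -> y = y') ->
  (forall x x' y, r x y -> r x' y -> x = x') ->
  exists f : S -> T, bijective f /\ forall x y, f x = y <-> r x y.
Proof.
move=> tot sur fun_r inj_r.
pose f x := projT1 (cid (tot x)); pose g y := projT1 (cid (sur y)).
have fE x : r x (f x) by rewrite /f; case: cid.
have gE y : r (g y) y by rewrite /g; case: cid.
exists f; split.
  by exists g => [x|y]; [apply: inj_r (gE _) (fE _)|apply: fun_r (fE _) (gE _)].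
by move=> x y; split=> [<- //|]; exact: fun_r (fE x).
Qed.

Section SheafMaps.
Variable X : topologicalType.

Lemma psh_map_eq (P Q : presheaf X) (f g : psh_map P Q) :
  (forall U s, f U s = g U s) -> f = g.
Proof.
case: f g => [f pf] [g pg] /= e.
have {}e : f = g by do 2!apply: functional_extensionality_dep => ?; exact: e.
by subst g; congr PshMap; exact: Prop_irrelevance.
Qed.

Section OfRel.
Variables (P Q : presheaf X) (r : forall V : opens X, P V -> Q V -> Prop).

Definition rel_res_stable := forall (U V : opens X) (h : V `<=` U) s t,
  r s t -> r (pres h s) (pres h t).
Definition rel_functional := forall (V : opens X) (s : P V) (t t' : Q V),
  r s t -> r s t' -> t = t'.
Definition rel_locally_total := forall (U : opens X) (s : P U) x, U x ->
  exists (V : opens X) (h : V `<=` U) (t : Q V), V x /\ r (pres h s) t.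

(** A section s of P over U determines local sections of Q, the values of r on
    the restrictions of s where r is defined; being single-valued and stable
    under restriction, r makes them agree on overlaps, so they glue. *)
Lemma psh_map_of_rel : is_sheaf Q ->
  rel_res_stable -> rel_functional -> rel_locally_total ->
  exists f : psh_map P Q, forall V s t, r s t -> f V s = t.
Proof.
move=> shQ r_res r_fun r_tot.
have glue (U : opens X) (s : P U) : exists! t : Q U,
    forall (V : opens X) (h : V `<=` U) u, r (pres h s) u -> pres h t = u.
  pose I := {V : opens X | exists (h : V `<=` U) u, r (pres h s) u}.
  have hI (i : I) : sval i `<=` U by case: (svalP i).
  have uI (i : I) : exists u, r (pres (hI i) s) u.
    by have [h [u ru]] := svalP i; exists u; rewrite (Prop_irrelevance (hI i) h).
  have cI : covers (fun i : I => sval i) U.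
    move=> x Ux; have [V [h [u [Vx ru]]]] := r_tot U s x Ux.
    pose P' (V : opens X) := exists (h : V `<=` U) u, r (pres h s) u.
    have PV : P' V by exists h, u.
    by exists (exist P' V PV).
  (* The cover consists of all the open sets on which r is defined at s. *)
  have [|t [tE tu]] := shQ U I _ hI cI (fun i => projT1 (cid (uI i))).
    move=> i j; case: cid => u ru; case: cid => v rv /=.
    apply: (r_fun _ (pres (subset_trans (@opensIl _ (sval i) (sval j)) (hI i)) s)).
      by rewrite -(pres_comp (hI i) (@opensIl _ _ _)); exact: r_res.
    rewrite (Prop_irrelevance (subset_trans _ _)
      (subset_trans (@opensIr _ (sval i) (sval j)) (hI j))).
    by rewrite -(pres_comp (hI j) (@opensIr _ _ _)); exact: r_res.
  exists t; split.
    move=> V h u ru; pose P' (V : opens X) := exists (h : V `<=` U) u, r (pres h s) u.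
    have PV : P' V by exists h, u.
    have := tE (exist P' V PV); case: cid => v /=.
    by rewrite (Prop_irrelevance (hI (exist P' V PV)) h) => rv ->; exact: r_fun rv ru.
  move=> t' t'E; apply: tu => i; case: cid => u ru /=; exact: t'E.
pose f (U : opens X) s := projT1 (cid (glue U s)).
have fE (U : opens X) s (V : opens X) (h : V `<=` U) u : r (pres h s) u -> pres h (f U s) = u.
  by rewrite /f; case: cid => t [tE _] /= /tE.
have f_res (U V : opens X) (h : V `<=` U) s : f V (pres h s) = pres h (f U s).
  rewrite {1}/f; case: cid => t [_ tu] /=; apply: tu => W k u.
  rewrite (pres_comp _ _ (subset_trans k h)) => ru.
  by rewrite (pres_comp _ _ (subset_trans k h)); exact: fE.
exists (PshMap f_res) => V s t /= rst.
by rewrite -[f V s](pres_id (@subset_refl _ _)); apply: fE; rewrite pres_id.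
Qed.

End OfRel.

Lemma sheaf_iso_of_rel (P Q : presheaf X) (r : forall V : opens X, P V -> Q V -> Prop) :
  is_sheaf P -> is_sheaf Q -> rel_res_stable r ->
  rel_functional r -> rel_locally_total r ->
  rel_functional (fun V t s => r V s t) -> rel_locally_total (fun V t s => r V s t) ->
  exists (f : psh_map P Q) (g : psh_map Q P),
    [/\ forall V, cancel (f V) (g V), forall V, cancel (g V) (f V)
      & forall V s t, r V s t -> f V s = t].
Proof.
move=> shP shQ r_res r_fun r_tot q_fun q_tot.
have [f fE] := psh_map_of_rel shQ r_res r_fun r_tot.
have [g gE] := @psh_map_of_rel Q P (fun V t s => r V s t) shP
  (fun U V h t s => @r_res U V h s t) q_fun q_tot.
exists f, g; split=> // V.
- move=> s; apply: (sheaf_sep_loc shP) => x Vx.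
  have [W [h [t [Wx rt]]]] := r_tot V s x Vx; exists W, h; split=> //.
  by rewrite -!pmap_res (fE _ _ _ rt) (gE _ _ _ rt).
- move=> t; apply: (sheaf_sep_loc shQ) => x Vx.
  have [W [h [s [Wx rt]]]] := q_tot V t x Vx; exists W, h; split=> //.
  by rewrite -!pmap_res (gE _ _ _ rt) (fE _ _ _ rt).
Qed.

(** A presheaf that is isomorphic over the open subsets of V to a sheaf has
    already all the sections over V of the sheaf that it generates: locally
    given sections are pulled back to the sheaf P, glued there and pushed
    forward. It avoids computing with germs in tensor sheaves. *)
Lemma eta_bijective (P Q : presheaf X) (V : opens X)
    (c : forall W : opens X, W `<=` V -> P W -> Q W) :
  is_sheaf P ->
  (forall (W W' : opens X) (h : W `<=` V) (h' : W' `<=` V) (k : W' `<=` W) p,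
     c W' h' (pres k p) = pres k (c W h p)) ->
  (forall (W : opens X) (h : W `<=` V), bijective (c W h)) ->
  bijective (@eta X Q V).
Proof.
move=> shP c_res c_bij.
have inj (W : opens X) (h : W `<=` V) : injective (@eta X Q W).
  have [d dK cK] := c_bij W h.
  move=> s t /eta_eqP e; rewrite -[s]cK -[t]cK; congr (c W h _).
  apply: (sheaf_sep_loc shP) => x Wx; have [Z [k [Zx ez]]] := e x Wx.
  exists Z, k; split=> //; apply: (bij_inj (c_bij Z (subset_trans k h))).
  by rewrite !(c_res _ _ h) !cK.
have sur (t : generated Q V) : exists s, eta V s = t.
  have hI : V `<=` V by [].
  pose r_at (W : opens X) := exists (h : W `<=` V) p, pres h t = eta W (c W h p).
  pose I := {W : opens X | r_at W}.
  have hV (i : I) : sval i `<=` V by case: (svalP i).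
  have pI (i : I) : exists p, pres (hV i) t = eta (sval i) (c _ (hV i) p).
    by have [h [p e]] := svalP i; exists p; rewrite (Prop_irrelevance (hV i) h).
  have cI : covers (fun i : I => sval i) V.
    move=> x Vx; have [W [Wx [h [s e]]]] := generatedP t Vx.
    have [d _ cK] := c_bij W h.
    have rW : r_at W by exists h, (d s); rewrite cK.
    by exists (exist r_at W rW).
  have [|p [pE _]] := shP V I _ hV cI (fun i => projT1 (cid (pI i))).
    move=> i j; case: cid => p ep; case: cid => q eq /=.
    have kl := subset_trans (@opensIl _ (sval i) (sval j)) (hV i).
    apply: (bij_inj (c_bij _ kl)); apply: (inj _ kl).
    rewrite (c_res _ _ (hV i)) (c_res _ _ (hV j)) !pmap_res -ep -eq.
    by rewrite !(pres_comp _ _ kl).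
  exists (c V hI p); apply: (sheaf_sep (@generated_sheaf _ _) (hV := hV) cI) => i.
  have := pE i; case: cid => q e pqE.
  have {}pE : pres (hV i) p = q := pqE.
  by rewrite e -pE (c_res _ _ hI) pmap_res.
exists (fun t => projT1 (cid (sur t))) => [s|t]; case: cid => //= s' e.
exact: (inj V (@subset_refl _ _)).
Qed.

End SheafMaps.

(** * Tensor products with a free factor; matrices over a module *)
Section ElementaryTensors.
Variables (R : comPzRingType) (M N : lmodType R).

Definition ptens (m : M) (n : N) : tensor M N := tens [:: (m, n)].

Lemma ptensDl m m' n : ptens (m + m') n = ptens m n + ptens m' n.
Proof. by rewrite tens_addrE; apply/tensP; exact: TensDl. Qed.

Lemma ptensDr m n n' : ptens m (n + n') = ptens m n + ptens m n'.
Proof. by rewrite tens_addrE; apply/tensP; exact: TensDr. Qed.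

Lemma ptensZl a m n : ptens (a *: m) n = a *: ptens m n.
Proof. by rewrite tens_scalerE. Qed.

Lemma ptensZr a m n : ptens m (a *: n) = a *: ptens m n.
Proof. by rewrite -ptensZl; apply/tensP; apply: TensSym; exact: TensZ. Qed.

Lemma ptens0l n : ptens 0 n = 0.
Proof. by apply/tensP; exact: Tens0. Qed.

Lemma ptens0r m : ptens m 0 = 0.
Proof. by rewrite -(scale0r (0 : N)) ptensZr scale0r. Qed.

Lemma ptens_suml (I : finType) (F : I -> M) n :
  ptens (\sum_i F i) n = \sum_i ptens (F i) n.
Proof. exact: (big_morph (ptens^~ n) (fun m m' => ptensDl m m' n) (ptens0l n)). Qed.

Lemma ptens_sumr (I : finType) m (F : I -> N) :
  ptens m (\sum_i F i) = \sum_i ptens m (F i).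
Proof. exact: (big_morph (ptens m) (ptensDr m) (ptens0r m)). Qed.

Lemma tensor_ind (P : tensor M N -> Prop) : P 0 -> (forall m n, P (ptens m n)) ->
  (forall c c', P c -> P c' -> P (c + c')) -> forall c, P c.
Proof. exact: tens_ind. Qed.

End ElementaryTensors.

Section UniversalProperty.
Variables (R : comPzRingType) (M N : lmodType R) (P : zmodType) (b : M -> N -> P).
Hypotheses (bDl : forall m m' n, b (m + m') n = b m n + b m' n)
  (bDr : forall m n n', b m (n + n') = b m n + b m n')
  (bZ : forall a m n, b (a *: m) n = b m (a *: n)).

(** The sum of b m n over the terms of a formal sum respects each generator of
    the congruence, hence descends to the quotient. *)
Lemma tens_lift : exists f : tensor M N -> P,
  [/\ forall m n, f (ptens m n) = b m n, f 0 = 0 & {morph f : c c' / c + c'}].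
Proof.
pose f (s : seq (M * N)) := \sum_(p <- s) b p.1 p.2.
have fE s t : tens_eq s t -> f s = f t.
  elim=> {s t} //=; rewrite /f.
  - by move=> s t u _ -> _ ->.
  - by move=> s s' t t' _ e _ e'; rewrite !big_cat /= e e'.
  - by move=> s t; rewrite !big_cat /= addrC.
  - by move=> m m' n; rewrite !big_cons !big_nil /= bDl addrA.
  - by move=> m n n'; rewrite !big_cons !big_nil /= bDr addrA.
  - by move=> a m n; rewrite !big_seq1 bZ.
  - move=> n; rewrite big_seq1 big_nil; apply: (addrI (b 0 n)).
    by rewrite -bDl !addr0.
have fT s : f (qrepr (tens s)) = f s by apply: fE; exact: tens_repr.
exists (fun c => f (qrepr c)); split.
- by move=> m n; rewrite fT /f big_seq1.
- by rewrite fT /f big_nil.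
- move=> c c'; have [s ->] := tensE c; have [s' ->] := tensE c'.
  by rewrite tens_addrE !fT /f big_cat.
Qed.

End UniversalProperty.

Section Swap.
Variable R : comPzRingType.

Lemma tens_swap (M N : lmodType R) : exists f : tensor M N -> tensor N M,
  [/\ forall m n, f (ptens m n) = ptens n m, f 0 = 0 & {morph f : c c' / c + c'}].
Proof.
apply: tens_lift => [m m' n|m n n'|a m n]; first exact: ptensDr.
  exact: ptensDl.
by rewrite ptensZr ptensZl.
Qed.

End Swap.

(** When M is free with basis e and coordinates co, contracting with the
    coordinate co_i recovers the i-th coefficient of a tensor, so that
    M ⊗ N is a sum of copies of N. *)
Section FreeFactor.
Variables (R : comPzRingType) (M N : lmodType R) (I : finType).
Variables (e : I -> M) (co : I -> M -> R).
Hypotheses (co_lin : forall i a m m', co i (a *: m + m') = a * co i m + co i m')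
  (co_e : forall i j, co i (e j) = (i == j)%:R)
  (e_co : forall m, m = \sum_i co i m *: e i).

Lemma tens_free_inj (w w' : I -> N) :
  \sum_i ptens (e i) (w i) = \sum_i ptens (e i) (w' i) -> w =1 w'.
Proof.
have coD i m m' : co i (m + m') = co i m + co i m'.
  by have := co_lin i 1 m m'; rewrite scale1r mul1r.
have co0 i : co i 0 = 0 by apply: (addrI (co i 0)); rewrite -coD !addr0.
have coZ i a m : co i (a *: m) = a * co i m.
  by have := co_lin i a m 0; rewrite co0 !addr0.
move=> E i.
have [|||f [fE f0 fD]] := @tens_lift R M N N (fun m n => co i m *: n).
- by move=> m m' n; rewrite coD scalerDl.
- by move=> m n n'; rewrite scalerDr.
- by move=> a m n; rewrite coZ mulrC scalerA.
have fS (u : I -> N) : f (\sum_j ptens (e j) (u j)) = u i.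
  rewrite (big_morph f fD f0) (bigD1 i) //= big1 => [|j ji].
    by rewrite fE co_e eqxx scale1r addr0.
  by rewrite fE co_e eq_sym (negPf ji) scale0r.
by rewrite -[w i]fS E fS.
Qed.

Lemma tens_free_sur (c : tensor M N) :
  exists w : I -> N, c = \sum_i ptens (e i) (w i).
Proof.
elim/tensor_ind: c => [|m n|c c' [w ->] [w' ->]].
- by exists (fun=> 0); rewrite big1 // => i _; exact: ptens0r.
- exists (fun i => co i m *: n); rewrite [in LHS](e_co m) ptens_suml.
  by apply: eq_bigr => i _; rewrite ptensZl ptensZr.
- exists (fun i => w i + w' i); rewrite -big_split.
  by apply: eq_bigr => i _; rewrite ptensDr.
Qed.

(** The same with the free factor on the right, by the symmetry of ⊗. *)
Lemma tens_freer_inj (w w' : I -> N) :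
  \sum_i ptens (w i) (e i) = \sum_i ptens (w' i) (e i) -> w =1 w'.
Proof.
move=> E; apply: tens_free_inj; have [f [fE f0 fD]] := tens_swap N M.
have := congr1 f E; rewrite !(big_morph f fD f0).
by under eq_bigr do rewrite fE; under [in RHS]eq_bigr do rewrite fE.
Qed.

Lemma tens_freer_sur (c : tensor N M) :
  exists w : I -> N, c = \sum_i ptens (w i) (e i).
Proof.
have [f [fE f0 fD]] := tens_swap N M; have [g [gE g0 gD]] := tens_swap M N.
have fK : cancel f g.
  elim/tensor_ind => [|m n|d d' e1 e2]; first by rewrite f0 g0.
    by rewrite fE gE.
  by rewrite fD gD e1 e2.
have [w cE] := tens_free_sur (f c); exists w; rewrite -[c]fK cE.
by rewrite (big_morph g gD g0); apply: eq_bigr => i _; exact: gE.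
Qed.

End FreeFactor.

Section ModuleMatrices.
Variables (R : comPzRingType) (M : lmodType R).

(** Matrices over a module have no product of their own; [lmulf] and [rmulf]
    are the two actions of matrices over the ring. *)
Definition lmulf m n p (B : 'M[R]_(m, n)) (t : 'M[M]_(n, p)) : 'M[M]_(m, p) :=
  \matrix_(i, j) \sum_k B i k *: t k j.

Definition rmulf m n p (t : 'M[M]_(m, n)) (B : 'M[R]_(n, p)) : 'M[M]_(m, p) :=
  \matrix_(i, j) \sum_k B k j *: t i k.

Lemma lmulfA m n p q (B : 'M[R]_(m, n)) (C : 'M[R]_(n, p)) (t : 'M[M]_(p, q)) :
  lmulf (B *m C) t = lmulf B (lmulf C t).
Proof.
apply/matrixP => i j; rewrite !mxE.
under eq_bigr do rewrite !mxE scaler_suml.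
rewrite exchange_big; apply: eq_bigr => l _; rewrite mxE scaler_sumr.
by apply: eq_bigr => k _; rewrite scalerA.
Qed.

Lemma rmulfA m n p q (t : 'M[M]_(m, n)) (B : 'M[R]_(n, p)) (C : 'M[R]_(p, q)) :
  rmulf t (B *m C) = rmulf (rmulf t B) C.
Proof.
apply/matrixP => i j; rewrite !mxE.
under eq_bigr do rewrite !mxE scaler_suml.
rewrite exchange_big; apply: eq_bigr => l _; rewrite mxE scaler_sumr.
by apply: eq_bigr => k _; rewrite scalerA mulrC.
Qed.

Lemma lrmulfA m n p q (B : 'M[R]_(m, n)) (t : 'M[M]_(n, p)) (C : 'M[R]_(p, q)) :
  lmulf B (rmulf t C) = rmulf (lmulf B t) C.
Proof.
apply/matrixP => i j; rewrite !mxE.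
under eq_bigr do rewrite !mxE scaler_sumr.
rewrite exchange_big; apply: eq_bigr => l _; rewrite mxE scaler_sumr.
by apply: eq_bigr => k _; rewrite !scalerA mulrC.
Qed.

(** A scalar acts on a matrix over M as the corresponding scalar matrix, so
    that the rules for [lmulf] also govern scaling. *)
Lemma lmulf_scalar m n a (t : 'M[M]_(m, n)) : lmulf a%:M t = map_mx ( *:%R a) t.
Proof.
apply/matrixP => i j; rewrite !mxE (bigD1 i) //= big1 => [|k ki].
  by rewrite !mxE eqxx addr0.
by rewrite !mxE eq_sym (negPf ki) scale0r.
Qed.

Lemma lmulf1 m n (t : 'M[M]_(m, n)) : lmulf 1%:M t = t.
Proof. by rewrite lmulf_scalar; apply/matrixP => i j; rewrite mxE scale1r. Qed.

Lemma rmulfZr m n p a (t : 'M[M]_(m, n)) (B : 'M[R]_(n, p)) :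
  rmulf t (a *: B) = lmulf a%:M (rmulf t B).
Proof.
apply/matrixP => i j; rewrite lmulf_scalar !mxE scaler_sumr.
by apply: eq_bigr => k _; rewrite mxE scalerA.
Qed.

Lemma lmulfD m n p (B : 'M[R]_(m, n)) (t u : 'M[M]_(n, p)) :
  lmulf B (t + u) = lmulf B t + lmulf B u.
Proof.
apply/matrixP => i j; rewrite !mxE -big_split; apply: eq_bigr => k _.
by rewrite mxE scalerDr.
Qed.

Lemma rmulfDl m n p (t u : 'M[M]_(m, n)) (B : 'M[R]_(n, p)) :
  rmulf (t + u) B = rmulf t B + rmulf u B.
Proof.
apply/matrixP => i j; rewrite !mxE -big_split; apply: eq_bigr => k _.
by rewrite mxE scalerDr.
Qed.

Lemma rmulfDr m n p (t : 'M[M]_(m, n)) (B C : 'M[R]_(n, p)) :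
  rmulf t (B + C) = rmulf t B + rmulf t C.
Proof.
apply/matrixP => i j; rewrite !mxE -big_split; apply: eq_bigr => k _.
by rewrite mxE scalerDl.
Qed.

Lemma rmulf_delta m n (t : 'M[M]_(m, n)) (j : 'I_n) :
  rmulf t (delta_mx j 0 : 'cV_n) = col j t.
Proof.
apply/matrixP => i l; rewrite !mxE (bigD1 j) //= big1 => [|k kj].
  by rewrite !mxE ord1 !eqxx scale1r addr0.
by rewrite !mxE (negPf kj) scale0r.
Qed.

Lemma rmulf_col m n p (t : 'M[M]_(m, n)) (B : 'M[R]_(n, p)) (j : 'I_p) :
  rmulf t (col j B) = col j (rmulf t B).
Proof. by apply/matrixP => i l; rewrite !mxE; apply: eq_bigr => k _; rewrite mxE. Qed.

End ModuleMatrices.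

(** * Sections of E ⊗ N in a local frame *)
Section ModuleSheaves.
Variables (K : fieldType) (X : topologicalType) (A : algebra_sheaf K X).

Lemma mod_res_sum (M : module_presheaf A) (U V : opens X) (h : V `<=` U)
    (I : finType) (F : I -> M U) :
  mod_res h (\sum_i F i) = \sum_i mod_res h (F i).
Proof. exact: (big_morph _ (mod_resD h) (mod_res0 M h)). Qed.

Section MatrixSheaf.
Variable M : module_sheaf A.

Definition mxf_res m n (U V : opens X) (h : V `<=` U) (t : 'M[M U]_(m, n)) :
  'M[M V]_(m, n) := map_mx (@mod_res _ _ _ M U V h) t.

Lemma mxf_res_id m n (U : opens X) (h : U `<=` U) (t : 'M[M U]_(m, n)) :
  mxf_res h t = t.
Proof. by apply/matrixP => i j; rewrite !mxE mod_res_id. Qed.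

Lemma mxf_res_comp m n (U V W : opens X) (h : V `<=` U) (h' : W `<=` V)
  (h'' : W `<=` U) (t : 'M[M U]_(m, n)) : mxf_res h' (mxf_res h t) = mxf_res h'' t.
Proof. by apply/matrixP => i j; rewrite !mxE (mod_res_comp _ _ h''). Qed.

Definition mxf_psh m n : presheaf X :=
  @Presheaf X (fun U => 'M[M U]_(m, n) : Type) (@mxf_res m n)
    (@mxf_res_id m n) (@mxf_res_comp m n).

Lemma mxf_is_sheaf m n : is_sheaf (mxf_psh m n).
Proof.
move=> U I V hV cV s cs.
have H (ij : 'I_m * 'I_n) : exists! t : M U,
    forall k, mod_res (hV k) t = s k ij.1 ij.2.
  apply: (@msh_is_sheaf _ _ _ M U I V hV cV (fun k => s k ij.1 ij.2)) => k l.
  by have /matrixP /(_ ij.1 ij.2) := cs k l; rewrite !mxE.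
pose t : 'M[M U]_(m, n) := \matrix_(i, j) projT1 (cid (H (i, j))).
exists t; split=> [k|t' e].
  apply/matrixP => i j; rewrite !mxE; case: cid => u [/= eu _]; exact: eu.
apply/matrixP => i j; rewrite !mxE; case: cid => u [/= _]; apply => k.
by rewrite -e !mxE.
Qed.

Section Restriction.
Variables (U V : opens X) (h : V `<=` U).

Lemma mxf_resD m n (t u : 'M[M U]_(m, n)) :
  mxf_res h (t + u) = mxf_res h t + mxf_res h u.
Proof. by apply/matrixP => i j; rewrite !mxE mod_resD. Qed.

Lemma mxf_res_lmulf m n p (B : 'M[A U]_(m, n)) (t : 'M[M U]_(n, p)) :
  mxf_res h (lmulf B t) = lmulf (mx_res h B) (mxf_res h t).
Proof.
apply/matrixP => i j; rewrite !mxE mod_res_sum; apply: eq_bigr => k _.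
by rewrite mod_resZ !mxE.
Qed.

Lemma mxf_res_rmulf m n p (t : 'M[M U]_(m, n)) (B : 'M[A U]_(n, p)) :
  mxf_res h (rmulf t B) = rmulf (mxf_res h t) (mx_res h B).
Proof.
apply/matrixP => i j; rewrite !mxE mod_res_sum; apply: eq_bigr => k _.
by rewrite mod_resZ !mxE.
Qed.

Lemma mxf_res_col m n (t : 'M[M U]_(m, n)) j : mxf_res h (col j t) = col j (mxf_res h t).
Proof. by apply/matrixP => i l; rewrite !mxE. Qed.

End Restriction.
End MatrixSheaf.

Section GeneratedModules.
Variables (M : module_presheaf A) (U : opens X).

(** The canonical map into the generated sheaf, typed so that its values are
    elements of a module. *)
Definition mod_eta (s : M U) : generated_module M U := @eta X (mod_psh M) U s.

Lemma mod_etaD s t : mod_eta (s + t) = mod_eta s + mod_eta t.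
Proof. by rewrite [RHS]gen_op_eta. Qed.

Lemma mod_eta0 : mod_eta 0 = 0. Proof. by []. Qed.

Lemma mod_etaZ (a : A U) s : mod_eta (a *: s) = a *: mod_eta s.
Proof. by rewrite [RHS]gen_op_eta. Qed.

Lemma mod_eta_sum (I : finType) (F : I -> M U) :
  mod_eta (\sum_i F i) = \sum_i mod_eta (F i).
Proof. exact: (big_morph _ mod_etaD mod_eta0). Qed.

End GeneratedModules.

Lemma mod_eta_res (M : module_presheaf A) (U V : opens X) (h : V `<=` U) (s : M U) :
  mod_res h (mod_eta s) = mod_eta (mod_res h s).
Proof. by rewrite /mod_eta [RHS](pmap_res (@eta X (mod_psh M))). Qed.

Lemma otimes_res (M N : module_presheaf A) (U V : opens X) (h : V `<=` U) (s : M U) (t : N U) :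
  mod_res h (otimes s t) = otimes (mod_res h s) (mod_res h t).
Proof. by rewrite [LHS]mod_eta_res /= ptens_resE. Qed.

Section IsoBasis.
Variables (n : nat) (E : module_sheaf A) (V : opens X).
Variable f : iso_on V (free_sheaf A n) E.

Section At.
Variables (W : opens X) (h : W `<=` V).

Definition iso_vec (k : 'I_n) : E W := iso_app f h (std_basis A W k).

Lemma isoD (a b : 'cV[A W]_n) : iso_app f h (a + b : 'cV_n) = iso_app f h a + iso_app f h b.
Proof. by have := iso_lin f h 1 a b; rewrite !scale1r. Qed.

Lemma iso0 : iso_app f h (0 : 'cV[A W]_n) = 0.
Proof. by apply: (addrI (iso_app f h (0 : 'cV[A W]_n))); rewrite -isoD !addr0. Qed.

Lemma isoZ x (a : 'cV[A W]_n) : iso_app f h (x *: a : 'cV_n) = x *: iso_app f h a.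
Proof. by have := iso_lin f h x a (0 : 'cV[A W]_n); rewrite iso0 !addr0. Qed.

Lemma isoE (a : 'cV[A W]_n) : iso_app f h a = \sum_k a k 0 *: iso_vec k.
Proof.
have {1}-> : a = \sum_k a k 0 *: (delta_mx k 0 : 'cV[A W]_n).
  apply/matrixP => k l; rewrite summxE (bigD1 k) //= big1 => [|k' nk].
    by rewrite !mxE eqxx ord1 eqxx mulr1 addr0.
  by rewrite !mxE eq_sym (negPf nk) mulr0.
by rewrite (big_morph (iso_app f h : 'cV[A W]_n -> E W) isoD iso0);
  apply: eq_bigr => k _; exact: isoZ.
Qed.

Lemma iso_col p (B : 'M[A W]_(n, p)) (j : 'I_p) :
  iso_app f h (col j B : 'cV_n) = \sum_k B k j *: iso_vec k.
Proof. by rewrite isoE; apply: eq_bigr => k _; rewrite mxE. Qed.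

End At.

Lemma iso_vec_res (W W' : opens X) (h : W `<=` V) (h' : W' `<=` V)
  (k : W' `<=` W) (i : 'I_n) : mod_res k (iso_vec h i) = iso_vec h' i.
Proof.
rewrite /iso_vec -(iso_res f h h' k); congr iso_app.
by apply/matrixP => l m; rewrite !mxE rmorph_nat.
Qed.

Section Tensor.
Variable N : module_sheaf A.

(** The element f ⊗ w of the presheaf tensor product over W, for the basis
    f_k of E(W) given by the isomorphism f. *)
Definition iso_ptens (W : opens X) (h : W `<=` V) (w : 'cV[N W]_n) :
  tensor (E W) (N W) := \sum_k ptens (iso_vec h k) (w k 0).

Lemma iso_ptens_res (W W' : opens X) (h : W `<=` V) (h' : W' `<=` V)
    (k : W' `<=` W) (w : 'cV[N W]_n) :
  iso_ptens h' (mxf_res k w) =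
  mod_res (m := tensor_presheaf E N) k (iso_ptens h w).
Proof.
rewrite /iso_ptens mod_res_sum; apply: eq_bigr => i _.
by rewrite [RHS]ptens_resE /= mxE (iso_vec_res h h').
Qed.

Lemma iso_ptens_bij (W : opens X) (h : W `<=` V) : bijective (@iso_ptens W h).
Proof.
have [g fK gK] := iso_bij f h.
pose co k (m : E W) := (g m : 'cV[A W]_n) k 0.
have g_lin (a : A W) (m m' : E W) : g (a *: m + m') = (a *: (g m : 'cV_n) + g m' : 'cV_n).
  apply: (bij_inj (iso_bij f h)); rewrite gK.
  by rewrite (iso_lin f h a (g m) (g m')) !gK.
have co_lin k a m m' : co k (a *: m + m') = a * co k m + co k m'.
  by rewrite /co g_lin !mxE.
have co_e i j : co i (iso_vec h j) = (i == j)%:R.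
  by rewrite /co fK /std_basis mxE eqxx andbT.
have e_co m : m = \sum_k co k m *: iso_vec h k by rewrite -[LHS]gK isoE.
have sur c : exists w : 'cV[N W]_n, c = iso_ptens h w.
  have [w ->] := tens_free_sur e_co c; exists (\col_k w k).
  by apply: eq_bigr => k _; rewrite mxE.
exists (fun c => projT1 (cid (sur c))) => [w|c]; case: cid => //= w' e.
by apply/matrixP => k l; rewrite ord1 (tens_free_inj co_lin co_e (esym e) k).
Qed.

Definition iso_tens (w : 'cV[N V]_n) : tensor_sheaf E N V :=
  @mod_eta (tensor_presheaf E N) V (iso_ptens (@subset_refl _ V) w).

Lemma iso_tensE w :
  iso_tens w = \sum_k otimes (iso_vec (@subset_refl _ V) k) (w k 0).
Proof. exact: mod_eta_sum. Qed.

(** Over the open subsets of V, the tensor presheaf is isomorphic by [iso_ptens]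
    to the sheaf of columns over N. *)
Lemma iso_tens_bij : bijective iso_tens.
Proof.
apply: (@bij_comp _ _ _ _ (@iso_ptens V (@subset_refl _ V))).
  exact: (@eta_bijective X (mxf_psh N n 1) (mod_psh (tensor_presheaf E N)) V
    iso_ptens (@mxf_is_sheaf N n 1) iso_ptens_res iso_ptens_bij).
exact: iso_ptens_bij.
Qed.

Lemma iso_tensD w w' : iso_tens (w + w') = iso_tens w + iso_tens w'.
Proof.
rewrite /iso_tens -mod_etaD; congr mod_eta; rewrite /iso_ptens -big_split.
by apply: eq_bigr => k _; rewrite mxE ptensDr.
Qed.

(** f ⊗ (B w) = sum_k f(B_k) ⊗ w_k, where B_k is the k-th column of B: with B
    square this is a change of basis, with B a single column it writes an
    elementary tensor f(a) ⊗ x in the basis. *)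
Lemma iso_tens_lmulf p (B : 'M[A V]_(n, p)) (w : 'cV[N V]_p) :
  iso_tens (lmulf B w) =
  \sum_k otimes (iso_app f (@subset_refl _ V) (col k B : 'cV_n)) (w k 0).
Proof.
under eq_bigr do rewrite iso_col.
rewrite /iso_tens /iso_ptens.
rewrite (eq_bigr (fun i => \sum_k ptens (B i k *: iso_vec (@subset_refl _ V) i) (w k 0))).
  rewrite exchange_big mod_eta_sum; apply: eq_bigr => k _.
  by congr mod_eta; rewrite -ptens_suml.
move=> i _; rewrite mxE ptens_sumr; apply: eq_bigr => k _.
by rewrite ptensZr ptensZl.
Qed.

Lemma iso_tensZ (a : A V) (w : 'cV[N V]_n) : iso_tens (lmulf a%:M w) = a *: iso_tens w.
Proof.
rewrite /iso_tens -mod_etaZ; congr mod_eta; rewrite /iso_ptens scaler_sumr.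
apply: eq_bigr => k _; rewrite -ptensZr; congr ptens.
by rewrite lmulf_scalar mxE.
Qed.


End Tensor.
End IsoBasis.

Lemma iso_tens_res (n : nat) (E N : module_sheaf A) (U V : opens X) (h : V `<=` U)
    (f : iso_on U (free_sheaf A n) E) (w : 'cV[N U]_n) :
  mod_res h (iso_tens f w) = iso_tens (iso_restrict h f) (mxf_res h w).
Proof.
rewrite /iso_tens mod_eta_res; congr mod_eta.
rewrite -(iso_ptens_res f (@subset_refl _ U) h h); apply: eq_bigr => k _.
by congr (ptens (iso_app f _ _) _); exact: Prop_irrelevance.
Qed.
End ModuleSheaves.

(** * Matrices of forms as sections of Omega ⊗ M_n(A) *)
Section Forms.
Variables (K : fieldType) (X : topologicalType) (A : algebra_sheaf K X).
Variable Omega : differential_triad A.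

Section MatrixForms.
Variable n : nat.

Definition pmx_form (U : opens X) (t : 'M[Omega U]_n) :
    tensor (Omega U) (mx_sheaf A n n U) :=
  \sum_i \sum_j ptens (t i j) (delta_mx i j : mx_sheaf A n n U).

Lemma mx_formE (U : opens X) (t : 'M[Omega U]_n) :
  mx_form t = @mod_eta _ _ _ (tensor_presheaf Omega (mx_sheaf A n n)) U (pmx_form t).
Proof.
by rewrite /pmx_form mod_eta_sum; apply: eq_bigr => i _; rewrite mod_eta_sum.
Qed.

Lemma pmx_formE (U : opens X) (t : 'M[Omega U]_n) :
  pmx_form t = \sum_ij ptens (t ij.1 ij.2) (delta_mx ij.1 ij.2 : mx_sheaf A n n U).
Proof. by rewrite /pmx_form pair_big. Qed.

Lemma pmx_form_res (U V : opens X) (k : V `<=` U) (t : 'M[Omega U]_n) :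
  pmx_form (mxf_res k t) =
  mod_res (m := tensor_presheaf Omega (mx_sheaf A n n)) k (pmx_form t).
Proof.
rewrite mod_res_sum; apply: eq_bigr => i _.
rewrite mod_res_sum; apply: eq_bigr => j _.
rewrite [RHS]ptens_resE /= mxE; congr (ptens _ _).
by apply/matrixP => l m; rewrite !mxE rmorph_nat.
Qed.

Lemma pmx_form_bij (U : opens X) : bijective (@pmx_form U).
Proof.
pose e (ij : 'I_n * 'I_n) : mx_sheaf A n n U := (delta_mx ij.1 ij.2 : 'M[A U]_n).
pose co (ij : 'I_n * 'I_n) (u : mx_sheaf A n n U) : A U := (u : 'M[A U]_n) ij.1 ij.2.
have co_lin ij a u v : co ij (a *: u + v) = a * co ij u + co ij v.
  by rewrite /co !mxE.
have co_e ij kl : co ij (e kl) = (ij == kl)%:R.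
  by rewrite /co /e mxE -pair_eqE.
have e_co u : u = \sum_ij co ij u *: e ij.
  by rewrite [LHS]matrix_sum_delta pair_big.
have sur c : exists t : 'M[Omega U]_n, c = pmx_form t.
  have [w ->] := tens_freer_sur e_co c; exists (\matrix_(i, j) w (i, j)).
  by rewrite pmx_formE; apply: eq_bigr => -[i j] _; rewrite mxE.
exists (fun c => projT1 (cid (sur c))) => [t|c]; case: cid => //= t' E.
apply/matrixP => i j; rewrite !pmx_formE in E.
exact: (esym (tens_freer_inj co_lin co_e E (i, j))).
Qed.

Lemma mx_form_bij (U : opens X) : bijective (@mx_form _ _ _ Omega n U).
Proof.
apply: (eq_bij _ (fun t => esym (mx_formE t))).
apply: (@bij_comp _ _ _ _ (@pmx_form U)); last exact: pmx_form_bij.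
apply: (@eta_bijective X (mxf_psh Omega n n)
  (mod_psh (tensor_presheaf Omega (mx_sheaf A n n))) U (fun W _ => @pmx_form W)).
- exact: mxf_is_sheaf.
- by move=> W W' _ _ k t; exact: pmx_form_res.
- by move=> W _; exact: pmx_form_bij.
Qed.

Lemma mx_formD (U : opens X) (t u : 'M[Omega U]_n) :
  mx_form (t + u) = mx_form t + mx_form u.
Proof.
rewrite !mx_formE -mod_etaD; congr mod_eta; rewrite -big_split; apply: eq_bigr => i _.
by rewrite -big_split; apply: eq_bigr => j _; rewrite mxE ptensDl.
Qed.

Lemma mx_form_res (U V : opens X) (h : V `<=` U) (t : 'M[Omega U]_n) :
  mod_res h (mx_form t) = mx_form (mxf_res h t).
Proof. by rewrite !mx_formE mod_eta_res pmx_form_res. Qed.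

Lemma Ad_act_res (U V : opens X) (h : V `<=` U) (g : GL A n U) (w : mx_forms Omega n U) :
  mod_res h (Ad_act g w) = Ad_act (gl_res h g) (mod_res h w).
Proof.
rewrite /Ad_act [LHS](pop_res (gen_op (Ad_op Omega n))); congr (gen_op _ _ _ _).
by rewrite -(pmap_res (@eta X (gl_sheaf A n))).
Qed.

Lemma pAdD (U : opens X) (g : GL A n U) : {morph pAd (Omega := Omega) g : c c' / c + c'}.
Proof.
move=> c c'.
have := @tens_map_lin _ _ (id : A U -> A U) (Omega U) (mx_sheaf A n n U) _ _ id (Ad g)
  _ _ _ 1 c c'.
by rewrite !scale1r; apply=> // a u v; exact: Ad_lin.
Qed.

(** The product of column i of B with row j of C. *)
Lemma delta_conj (U : opens X) (B C : 'M[A U]_n) (i j : 'I_n) :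
  B *m delta_mx i j *m C = \sum_k \sum_l (B k i * C j l) *: delta_mx k l.
Proof.
rewrite [LHS]matrix_sum_delta; apply: eq_bigr => k _; apply: eq_bigr => l _.
congr (_ *: _); rewrite mxE (bigD1 j) //= big1 => [|m mj].
  rewrite mxE (bigD1 i) //= big1 => [|m mi]; first by rewrite !mxE !eqxx mulr1 !addr0.
  by rewrite !mxE (negPf mi) mulr0.
rewrite mxE big1 ?mul0r // => q _.
by rewrite mxE (negPf mj) andbF mulr0.
Qed.

(** The adjoint action on Omega ⊗ M_n(A) is conjugation of the matrix of
    forms: moving the entries of g t_ij delta_ij g^-1 across ⊗ regroups the
    double sum over the matrices delta_kl. *)
Lemma mx_form_Ad (U : opens X) (g : GL A n U) (t : 'M[Omega U]_n) :
  Ad_act g (mx_form t) = mx_form (rmulf (lmulf g t) (gl_inv g)).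
Proof.
rewrite !mx_formE [LHS]gen_op_eta; congr mod_eta.
have pAd0 : pAd (Omega := Omega) g 0 = 0 by exact: pAdE.
rewrite !pmx_formE [LHS](big_morph _ (pAdD g) pAd0).
transitivity (\sum_(ij : 'I_n * 'I_n) \sum_(kl : 'I_n * 'I_n)
    ptens ((g kl.1 ij.1 * gl_inv g ij.2 kl.2) *: t ij.1 ij.2)
      (delta_mx kl.1 kl.2 : mx_sheaf A n n U)).
  apply: eq_bigr => -[i j] _.
  rewrite [LHS]pAdE /= [X in tens [:: (_, X)]]delta_conj pair_big -/(ptens _ _) ptens_sumr.
  by apply: eq_bigr => kl _; rewrite ptensZr ptensZl.
rewrite exchange_big; apply: eq_bigr => -[k l] _ /=; rewrite -ptens_suml; congr ptens.
rewrite mxE; under [in RHS]eq_bigr do rewrite mxE scaler_sumr.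
rewrite exchange_big pair_big; apply: eq_bigr => -[i j] _ /=.
by rewrite scalerA mulrC.
Qed.

End MatrixForms.
End Forms.

(** * The differential, the gauge action and the matrices of a linear connection *)
Section Differential.
Variables (K : fieldType) (X : topologicalType) (A : algebra_sheaf K X).
Variable Omega : differential_triad A.

Definition dmx m n (U : opens X) (B : 'M[A U]_(m, n)) : 'M[Omega U]_(m, n) :=
  \matrix_(i, j) dt_d Omega (B i j).

Section At.
Variable U : opens X.

Lemma dt_dD (a b : A U) : dt_d Omega (a + b) = dt_d Omega a + dt_d Omega b.
Proof. by have := dt_lin Omega 1 a b; rewrite rmorph1 mul1r scale1r. Qed.

Lemma dt_d0 : dt_d Omega (0 : A U) = 0.
Proof. by apply: (addrI (dt_d Omega (0 : A U))); rewrite -dt_dD !addr0. Qed.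

Lemma dt_d1 : dt_d Omega (1 : A U) = 0.
Proof.
apply: (addrI (dt_d Omega (1 : A U))); rewrite addr0.
by have := dt_leibniz Omega (1 : A U) 1; rewrite mulr1 scale1r.
Qed.

(** Constants are killed because d is K-linear and d 1 = 0; this is why the
    extra Leibniz term does not spoil the K-linearity of nabla. *)
Lemma dt_d_const k : dt_d Omega (alg_const A U k) = 0.
Proof. by have := dt_lin Omega k (1 : A U) 0; rewrite mulr1 dt_d1 dt_d0 scaler0 !addr0. Qed.

Lemma dmxD m n (B C : 'M[A U]_(m, n)) : dmx (B + C) = dmx B + dmx C.
Proof. by apply/matrixP => i j; rewrite !mxE dt_dD. Qed.

Lemma dmxM m n p (B : 'M[A U]_(m, n)) (C : 'M[A U]_(n, p)) :
  dmx (B *m C) = rmulf (dmx B) C + lmulf B (dmx C).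
Proof.
apply/matrixP => i j; rewrite !mxE (big_morph _ dt_dD dt_d0) -big_split.
by apply: eq_bigr => k _; rewrite !mxE dt_leibniz addrC.
Qed.

Lemma dmx_delta n (j : 'I_n) : dmx (delta_mx j 0 : 'cV[A U]_n) = 0.
Proof.
apply/matrixP => i l; rewrite !mxE.
by case: (_ && _); [exact: dt_d1|exact: dt_d0].
Qed.

Lemma dmxZ n a (b : 'cV[A U]_n) :
  dmx (a *: b) = lmulf a%:M (dmx b) + lmulf b (const_mx (dt_d Omega a) : 'M_(1, 1)).
Proof.
apply/matrixP => i j; rewrite lmulf_scalar !mxE big_ord1 !mxE (ord1 j).
exact: dt_leibniz.
Qed.

(** The matrix of a connection in the frame f.g, when t is its matrix in f. *)
Definition gauge n (t : 'M[Omega U]_n) (g : GL A n U) : 'M[Omega U]_n :=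
  rmulf (lmulf (gl_inv g) t) g + lmulf (gl_inv g) (dmx g).

(** The form g (t.g) = t g + dg of the gauge law is the one that the Leibniz
    rule yields directly, without g^-1. *)
Lemma lmulf_gauge n (t : 'M[Omega U]_n) (g : GL A n U) :
  lmulf g (gauge t g) = rmulf t g + dmx g.
Proof. by rewrite lmulfD lrmulfA -!lmulfA gl_mulmxV !lmulf1. Qed.

Lemma maurer_cartanE n (g : GL A n U) :
  maurer_cartan Omega g = mx_form (lmulf (gl_inv g) (dmx g)).
Proof.
congr mx_form; apply/matrixP => i j; rewrite !mxE.
by apply: eq_bigr => k _; rewrite mxE.
Qed.

Lemma mx_form_gauge n (t : 'M[Omega U]_n) (g : GL A n U) :
  mx_form (gauge t g) = Ad_act (gl_inv g) (mx_form t) + maurer_cartan Omega g.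
Proof. by rewrite mx_formD mx_form_Ad maurer_cartanE. Qed.

End At.

Lemma dmx_res m n (U V : opens X) (h : V `<=` U) (B : 'M[A U]_(m, n)) :
  mxf_res h (dmx B) = dmx (mx_res h B).
Proof. by apply/matrixP => i j; rewrite !mxE dt_res. Qed.

Lemma maurer_cartan_res n (U V : opens X) (h : V `<=` U) (g : GL A n U) :
  mod_res h (maurer_cartan Omega g) = maurer_cartan Omega (gl_res h g).
Proof. by rewrite !maurer_cartanE mx_form_res mxf_res_lmulf dmx_res. Qed.

End Differential.

Section Connections.
Variables (K : fieldType) (X : topologicalType) (A : algebra_sheaf K X).
Variables (n : nat) (E : module_sheaf A) (L : local_frames n E).

Section Frames.
Variable V : opens X.

Definition frame_app (f : frame L V) (a : 'cV[A V]_n) : E V :=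
  iso_app (frame_iso f) (@subset_refl _ V) a.

Lemma frame_app_inj f : injective (frame_app f).
Proof. exact: (bij_inj (iso_bij (frame_iso f) (@subset_refl _ V))). Qed.

Lemma frame_app_sur f e : exists a, e = frame_app f a.
Proof.
have [g _ gK] := iso_bij (frame_iso f) (@subset_refl _ V).
by exists (g e); rewrite /frame_app gK.
Qed.

Lemma frame_appZD f (x : A V) a b :
  frame_app f (x *: a + b) = x *: frame_app f a + frame_app f b.
Proof. exact: iso_lin. Qed.

Lemma frame_appZ f (x : A V) a : frame_app f (x *: a) = x *: frame_app f a.
Proof. exact: isoZ. Qed.

Lemma frame_app_mul f (g : GL A n V) a : frame_app (frame_mul f g) a = frame_app f (g *m a).
Proof.
rewrite /frame_app /= /frame_mul_app; congr iso_app; congr (_ *m _).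
exact: mx_res_id.
Qed.

Lemma frame_mulA (f : frame L V) (g g' : GL A n V) :
  frame_mul (frame_mul f g) g' = frame_mul f (gl_mul g g').
Proof.
apply: frame_eq; apply: iso_eq => W k a /=; rewrite /frame_mul_app /=.
by rewrite /frame_mul_app /= /mx_res !map_mxM mulmxA.
Qed.

(** Both frames are multiples of one natural frame, whose chart covers V. *)
Lemma frame_transition (f f' : frame L V) : exists g, f' = frame_mul f g.
Proof.
have [i hV] := frame_basis f; have [g fE] := frame_chart_surj hV f.
have [g' f'E] := frame_chart_surj hV f'; exists (gl_mul (gl_inv g) g').
rewrite fE f'E frame_mulA; congr frame_mul; apply: gl_eq => /=.
by rewrite mulmxA gl_mulmxV mul1mx.
Qed.

End Frames.

Lemma frame_app_res (U V : opens X) (h : V `<=` U) (f : frame L U) a :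
  frame_app (frame_res h f) (mx_res h a) = mod_res h (frame_app f a).
Proof.
rewrite /frame_app -(iso_res _ (@subset_refl _ U) h h) /=.
by congr iso_app; exact: Prop_irrelevance.
Qed.

(** The restrictions of the natural frames form a cover by frames. *)
Lemma frame_local (U : opens X) x : U x ->
  exists (V : opens X) (h : V `<=` U) (f : frame L V), V x.
Proof.
move=> Ux; have [i xi] := lf_cover L (Logic.I : [set: X] x).
exists (opensI U (lf_open i)), (@opensIl _ _ _).
by exists (frame_res (@opensIr _ _ _) (natural_frame i)).
Qed.

Variable Omega : differential_triad A.

Section FrameTensor.
Variable V : opens X.

Definition frame_tens (f : frame L V) (w : 'cV[Omega V]_n) : tensor_sheaf E Omega V :=
  iso_tens (frame_iso f) w.

Lemma frame_tens_bij f : bijective (frame_tens f).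
Proof. exact: iso_tens_bij. Qed.

Lemma frame_tensD f w w' : frame_tens f (w + w') = frame_tens f w + frame_tens f w'.
Proof. exact: iso_tensD. Qed.

Lemma frame_tensZ f (a : A V) w : frame_tens f (lmulf a%:M w) = a *: frame_tens f w.
Proof. exact: iso_tensZ. Qed.

Lemma frame_tens_mul f (g : GL A n V) w :
  frame_tens (frame_mul f g) w = frame_tens f (lmulf g w).
Proof.
rewrite /frame_tens iso_tensE iso_tens_lmulf; apply: eq_bigr => k _.
congr (otimes _ _); rewrite /iso_vec [LHS](frame_app_mul f g).
by rewrite colE.
Qed.

Lemma frame_tens_otimes f a (x : Omega V) :
  frame_tens f (lmulf a (const_mx x : 'M_(1, 1))) = otimes (frame_app f a) x.
Proof.
rewrite /frame_tens iso_tens_lmulf big_ord1 mxE; congr (otimes _ _).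
rewrite /frame_app; congr (iso_app _ _ _).
by apply/matrixP => i j; rewrite mxE (ord1 j).
Qed.

End FrameTensor.

Lemma frame_tens_res (U V : opens X) (h : V `<=` U) (f : frame L U) w :
  mod_res h (frame_tens f w) = frame_tens (frame_res h f) (mxf_res h w).
Proof. exact: iso_tens_res. Qed.

Section OfLinear.
Variable nabla : linear_connection Omega E.

(** t is the matrix of nabla in the frame f: column j holds the coordinates of
    nabla(f_j). *)
Definition conn_matrix (V : opens X) (f : frame L V) (t : 'M[Omega V]_n) : Prop :=
  forall j, nabla V (frame_app f (delta_mx j 0)) = frame_tens f (col j t).

Lemma conn_matrix_ex (V : opens X) (f : frame L V) : exists t, conn_matrix f t.
Proof.
have [g _ gK] := frame_tens_bij f.
exists (\matrix_(i, j) (g (nabla V (frame_app f (delta_mx j 0))) i 0)) => j.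
rewrite -[LHS]gK; congr frame_tens.
by apply/matrixP => i l; rewrite !mxE ord1.
Qed.

Lemma conn_matrix_uniq (V : opens X) (f : frame L V) t t' :
  conn_matrix f t -> conn_matrix f t' -> t = t'.
Proof.
move=> H H'; apply/matrixP => i j.
have := H j; rewrite H' => /(bij_inj (frame_tens_bij f)) /matrixP /(_ i 0).
by rewrite !mxE.
Qed.

(** Expand f(a) = sum_k a_k f_k and apply the Leibniz rule to each term. *)
Lemma conn_matrixE (V : opens X) (f : frame L V) t a : conn_matrix f t ->
  nabla V (frame_app f a) = frame_tens f (rmulf t a + dmx Omega a).
Proof.
move=> H; have nD s s' : nabla V (s + s') =
    ((nabla V s : tensor_sheaf E Omega V) + nabla V s' : tensor_sheaf E Omega V).
  by have := lc_lin nabla 1 s s'; rewrite rmorph1 !scale1r.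
have n0 : nabla V 0 = 0 :> tensor_sheaf E Omega V.
  apply: (addrI (nabla V 0 : tensor_sheaf E Omega V)).
  by rewrite -[LHS]nD !addr0.
have f0 : frame_tens f 0 = 0.
  by apply: (addrI (frame_tens f 0)); rewrite -frame_tensD !addr0.
rewrite frame_tensD /frame_app isoE [LHS](big_morph _ nD n0).
have -> : rmulf t a = \sum_k lmulf (a k 0)%:M (col k t).
  apply/matrixP => i l; rewrite summxE !mxE; apply: eq_bigr => k _.
  by rewrite lmulf_scalar !mxE ord1.
rewrite (big_morph _ (frame_tensD f) f0) /frame_tens iso_tensE -big_split.
apply: eq_bigr => k _.
by rewrite [LHS]lc_leibniz iso_tensZ [X in _ *: X]H mxE.
Qed.

Lemma conn_matrix_res (U V : opens X) (h : V `<=` U) (f : frame L U) t :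
  conn_matrix f t -> conn_matrix (frame_res h f) (mxf_res h t).
Proof.
move=> H j; have <- : mx_res h (delta_mx j 0 : 'cV[A U]_n) = delta_mx j 0.
  by apply/matrixP => i l; rewrite !mxE rmorph_nat.
rewrite frame_app_res; have /= -> := pmap_res nabla h (frame_app f (delta_mx j 0)).
by rewrite [X in gen_res _ X]H [LHS]frame_tens_res mxf_res_col.
Qed.

(** Column j of f.g is f(g_j), whose derivative is f ⊗ (t g_j + d g_j). *)
Lemma conn_matrix_gauge (V : opens X) (f : frame L V) t (g : GL A n V) :
  conn_matrix f t -> conn_matrix (frame_mul f g) (gauge t g).
Proof.
move=> H j; rewrite frame_app_mul (conn_matrixE _ H) frame_tens_mul; congr frame_tens.
have -> : lmulf g (col j (gauge t g)) = col j (lmulf g (gauge t g)).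
  by apply/matrixP => i l; rewrite !mxE; apply: eq_bigr => k _; rewrite mxE.
by rewrite lmulf_gauge -colE rmulf_col; apply/matrixP => i l; rewrite !mxE.
Qed.

End OfLinear.
End Connections.

(** * The correspondence of connections *)
Lemma module_sep (K : fieldType) (X : topologicalType) (A : algebra_sheaf K X)
    (M : module_sheaf A) (U : opens X) (s t : M U) :
  (forall x, U x -> exists (V : opens X) (h : V `<=` U), V x /\ mod_res h s = mod_res h t) ->
  s = t.
Proof. exact: (sheaf_sep_loc (@msh_is_sheaf _ _ _ M)). Qed.

Section Correspondence.
Variables (K : fieldType) (X : topologicalType) (A : algebra_sheaf K X).
Variable Omega : differential_triad A.
Variables (n : nat) (E : module_sheaf A) (L : local_frames n E).

Definition frame_section (V : opens X) (f : frame L V) : frame_sheaf L V :=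
  @eta X (frame_presheaf L) V f.

Lemma frame_section_res (U V : opens X) (h : V `<=` U) (f : frame L U) :
  pres h (frame_section f) = frame_section (frame_res h f).
Proof. by rewrite /frame_section -(pmap_res (@eta X (frame_presheaf L))). Qed.

Lemma frame_section_mul (V : opens X) (f : frame L V) (g : GL A n V) :
  ps_act (frame_section f) g = frame_section (frame_mul f g).
Proof. exact: frames_act_eta. Qed.

(** The correspondence read in every frame instead of the natural ones. As
    both matrices exist and are unique in each frame, either of nabla and D
    determines the other. *)
Definition same_matrices (nabla : linear_connection Omega E)
    (D : principal_connection Omega (frame_sheaf L)) : Prop :=
  forall (V : opens X) (f : frame L V) t,
    conn_matrix nabla f t -> D V (frame_section f) = mx_form t.

Lemma linear_connection_eq (nabla nabla' : linear_connection Omega E) :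
  (forall U s, nabla U s = nabla' U s) -> nabla = nabla'.
Proof.
case: nabla nabla' => [m p q] [m' p' q'] /= e.
have {}e : m = m' by exact: psh_map_eq.
by subst m'; congr LinearConnection; exact: Prop_irrelevance.
Qed.

Lemma principal_connection_eq (D D' : principal_connection Omega (frame_sheaf L)) :
  (forall U s, D U s = D' U s) -> D = D'.
Proof.
case: D D' => [m p] [m' p'] /= e.
have {}e : m = m' by exact: psh_map_eq.
by subst m'; congr PrincipalConnection; exact: Prop_irrelevance.
Qed.

Lemma local_form_conn_matrix (nabla : linear_connection Omega E) (i : lf_index L) t :
  local_form_of nabla t <-> conn_matrix nabla (natural_frame i) t.
Proof.
have e j : \sum_(k < n) otimes (basis_section i k) (t k j) =
    frame_tens (natural_frame i) (col j t) :> tensor_sheaf E Omega (lf_open i).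
  by rewrite [RHS]iso_tensE; apply: eq_bigr => k _; rewrite mxE.
by split=> H j; [rewrite -e|rewrite e]; exact: H.
Qed.

Lemma principal_res (D : principal_connection Omega (frame_sheaf L)) (U V : opens X)
    (h : V `<=` U) (f : frame L U) t :
  D U (frame_section f) = mx_form t ->
  D V (frame_section (frame_res h f)) = mx_form (mxf_res h t).
Proof. by rewrite -frame_section_res pmap_res => ->; exact: mx_form_res. Qed.

Lemma principal_gauge (D : principal_connection Omega (frame_sheaf L)) (V : opens X)
    (f : frame L V) t (g : GL A n V) :
  D V (frame_section f) = mx_form t ->
  D V (frame_section (frame_mul f g)) = mx_form (gauge t g).
Proof. by rewrite -frame_section_mul pc_act mx_form_gauge => ->. Qed.

(** A frame over V below U_i is the restricted natural frame times some g, and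
    both matrices change by the same gauge transformation. *)
Lemma local_forms_agreeE nabla D : local_forms_agree nabla D <-> same_matrices nabla D.
Proof.
split=> [H V f t ft|H i]; last first.
  have [t it] := conn_matrix_ex nabla (natural_frame i).
  by exists t; split; [exact/local_form_conn_matrix|exact: H].
have [i hV] := frame_basis f; have [t0 [/local_form_conn_matrix it0 Dt0]] := H i.
have [g fE] := frame_chart_surj hV f; rewrite fE in ft *.
have ft0 := conn_matrix_gauge g (conn_matrix_res hV it0).
by rewrite (conn_matrix_uniq ft ft0); apply/principal_gauge/principal_res.
Qed.

(** D sends a frame to the matrix of nabla in it. A section of the sheaf of
    frames is only locally a frame, and two frames with the same section are
    only locally equal; both are harmless since matrices of forms glue. *)
Lemma principal_of_linear nabla : exists D, same_matrices nabla D.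
Proof.
pose r (V : opens X) (s : frames L V) (t : mx_forms Omega n V) :=
  exists (f : frame L V) th, [/\ s = frame_section f, conn_matrix nabla f th & t = mx_form th].
have r_res : @rel_res_stable _ (frames L) (mod_psh (mx_forms Omega n)) r.
  move=> U V h s t [f [th [-> fth ->]]].
  exists (frame_res h f), (mxf_res h th); split; first exact: frame_section_res.
    exact: conn_matrix_res.
  exact: mx_form_res.
have r_fun : @rel_functional _ (frames L) (mod_psh (mx_forms Omega n)) r.
  move=> V s t t' [f [th [-> fth ->]]] [f' [th' [/eta_eqP e f'th' ->]]].
  congr mx_form; apply: (sheaf_sep_loc (@mxf_is_sheaf _ _ _ Omega n n)) => x Vx.
  have [W [h [Wx e']]] := e x Vx; exists W, h; split=> //.
  have e'' : frame_res h f = frame_res h f' := e'.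
  by apply: (conn_matrix_uniq (conn_matrix_res h fth)); rewrite e''; exact: conn_matrix_res.
have r_tot : @rel_locally_total _ (frames L) (mod_psh (mx_forms Omega n)) r.
  move=> U s x Ux; have [V [Vx [h [f e]]]] := generatedP s Ux.
  have [th fth] := conn_matrix_ex nabla f.
  by exists V, h, (mx_form th); split=> //; exists f, th.
have [D DE] := psh_map_of_rel (@generated_sheaf _ _) r_res r_fun r_tot.
have DfE V f th : conn_matrix nabla f th -> D V (frame_section f) = mx_form th.
  by move=> fth; apply: DE; exists f, th.
have D_act (U : opens X) (s : frames L U) (g : GL A n U) : D U (frames_act s g) =
    (Ad_act (gl_inv g) (D U s) + maurer_cartan Omega g : mx_forms Omega n U).
  have D_res (V : opens X) (h : V `<=` U) u :
      mod_res h (D U u : mx_forms Omega n U) = D V (pres h u).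
    exact: (esym (pmap_res D h u)).
  apply: (@module_sep _ _ _ (mx_forms Omega n)) => x Ux.
  have [V [Vx [h [f e]]]] := generatedP s Ux; exists V, h; split=> //.
  have [th fth] := conn_matrix_ex nabla f.
  rewrite mod_resD Ad_act_res maurer_cartan_res !D_res frames_act_res e.
  rewrite frames_act_eta [X in Ad_act _ X](DfE _ _ _ fth).
  have -> : gl_res h (gl_inv g) = gl_inv (gl_res h g) by exact: gl_eq.
  by rewrite [LHS](DfE _ _ _ (conn_matrix_gauge (gl_res h g) fth)) mx_form_gauge.
by exists (@PrincipalConnection _ _ _ Omega n (frame_sheaf L) D D_act).
Qed.

(** nabla(f(a)) = f ⊗ (t a + da), where t is the matrix of D(f). The choice of
    f does not matter: for f' = f.g and a = g a', the coordinates in f of the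
    second expression are g ((t.g) a' + da') = t a + (dg) a' + g da' = t a + da. *)
Lemma linear_of_principal D : exists nabla, same_matrices nabla D.
Proof.
pose r (V : opens X) (e : E V) (t : tensor_sheaf E Omega V) :=
  exists (f : frame L V) a th, [/\ e = frame_app f a, D V (frame_section f) = mx_form th
    & t = frame_tens f (rmulf th a + dmx Omega a)].
have r_res : @rel_res_stable _ (mod_psh E) (mod_psh (tensor_sheaf E Omega)) r.
  move=> U V h s t [f [a [th [-> fth ->]]]].
  exists (frame_res h f), (mx_res h a), (mxf_res h th); split.
  - exact: (esym (frame_app_res h f a)).
  - exact: principal_res.
  - by rewrite [LHS]frame_tens_res mxf_resD mxf_res_rmulf dmx_res.
have r_fun : @rel_functional _ (mod_psh E) (mod_psh (tensor_sheaf E Omega)) r.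
  move=> V s t t' [f [a [th [-> fth ->]]]] [f' [a' [th' [e f'th' ->]]]].
  have [g fE] := frame_transition f f'; rewrite fE in e f'th' *.
  rewrite frame_app_mul in e; rewrite (frame_app_inj e) frame_tens_mul; congr frame_tens.
  rewrite (principal_gauge g fth) in f'th'.
  rewrite -(bij_inj (mx_form_bij Omega n V) f'th') lmulfD lrmulfA lmulf_gauge.
  by rewrite rmulfDl -rmulfA dmxM addrA.
have D_ex (V : opens X) (f : frame L V) : exists th, D V (frame_section f) = mx_form th.
  have [g _ gK] := mx_form_bij Omega n V.
  by exists (g (D V (frame_section f))); rewrite gK.
have r_tot : @rel_locally_total _ (mod_psh E) (mod_psh (tensor_sheaf E Omega)) r.
  move=> U s x Ux; have [V [h [f Vx]]] := frame_local L Ux.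
  have [a aE] := frame_app_sur f (mod_res h s); have [th fth] := D_ex V f.
  by exists V, h, (frame_tens f (rmulf th a + dmx Omega a)); split=> //; exists f, a, th.
have [nabla nablaE] := psh_map_of_rel (@generated_sheaf _ _) r_res r_fun r_tot.
have nE V f a th : D V (frame_section f) = mx_form th ->
    nabla V (frame_app f a) = frame_tens f (rmulf th a + dmx Omega a).
  by move=> fth; apply: nablaE; exists f, a, th.
have n_res (U V : opens X) (h : V `<=` U) s :
    mod_res h (nabla U s : tensor_sheaf E Omega U) = nabla V (mod_res h s).
  exact: (esym (pmap_res nabla h s)).
have n_lin (U : opens X) k (s t : E U) : nabla U (alg_const A U k *: s + t) =
    (alg_const A U k *: (nabla U s : tensor_sheaf E Omega U) + nabla U t
       : tensor_sheaf E Omega U).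
  apply: (@module_sep _ _ _ (tensor_sheaf E Omega)) => x Ux.
  have [V [h [f Vx]]] := frame_local L Ux; exists V, h; split=> //.
  have [th fth] := D_ex V f.
  rewrite mod_res_lin !n_res mod_res_lin alg_res_const.
  have [a ->] := frame_app_sur f (mod_res h s); have [b ->] := frame_app_sur f (mod_res h t).
  rewrite -frame_appZD !(nE _ _ _ _ fth) -frame_tensZ -frame_tensD; congr frame_tens.
  rewrite dmxD dmxZ dt_d_const rmulfDr rmulfZr lmulfD.
  have -> : lmulf a (const_mx 0 : 'M[Omega V]_(1, 1)) = 0.
    by apply/matrixP => i j; rewrite !mxE big_ord1 mxE scaler0.
  by rewrite addr0 addrACA.
have n_leibniz (U : opens X) (a : A U) (s : E U) : nabla U (a *: s) =
    (a *: (nabla U s : tensor_sheaf E Omega U) + otimes s (dt_d Omega a)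
       : tensor_sheaf E Omega U).
  apply: (@module_sep _ _ _ (tensor_sheaf E Omega)) => x Ux.
  have [V [h [f Vx]]] := frame_local L Ux; exists V, h; split=> //.
  have [th fth] := D_ex V f.
  rewrite mod_resD mod_resZ !n_res mod_resZ otimes_res -dt_res.
  have [b ->] := frame_app_sur f (mod_res h s).
  rewrite -frame_appZ !(nE _ _ _ _ fth) -frame_tens_otimes -frame_tensZ -frame_tensD.
  by rewrite dmxZ rmulfZr lmulfD addrA.
pose nabla' := @LinearConnection _ _ _ Omega E nabla n_lin n_leibniz.
exists nabla' => V f t ft; have [th fth] := D_ex V f; rewrite fth; congr mx_form.
apply: (@conn_matrix_uniq _ _ _ _ _ _ _ nabla' V f) => // j.
by rewrite [LHS](nE _ _ _ _ fth) dmx_delta addr0 rmulf_delta.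
Qed.

Lemma same_matrices_inj nabla nabla' D :
  same_matrices nabla D -> same_matrices nabla' D -> nabla = nabla'.
Proof.
move=> H H'; apply: linear_connection_eq => U s.
apply: (@module_sep _ _ _ (tensor_sheaf E Omega)) => x Ux.
have [V [h [f Vx]]] := frame_local L Ux; exists V, h; split=> //.
have [a sE] := frame_app_sur f (mod_res h s).
have [t ft] := conn_matrix_ex nabla f; have [t' ft'] := conn_matrix_ex nabla' f.
have tt' : t = t'.
  by apply: (bij_inj (mx_form_bij Omega n V)); rewrite -(H _ _ _ ft) (H' _ _ _ ft').
have nE (m : linear_connection Omega E) :
    mod_res h (m U s : tensor_sheaf E Omega U) = m V (frame_app f a).
  by rewrite -sE; exact: (esym (pmap_res m h s)).
by rewrite !nE (conn_matrixE _ ft) (conn_matrixE _ ft') tt'.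
Qed.

Lemma same_matrices_fun nabla D D' :
  same_matrices nabla D -> same_matrices nabla D' -> D = D'.
Proof.
move=> H H'; apply: principal_connection_eq => U s.
apply: (@module_sep _ _ _ (mx_forms Omega n)) => x Ux.
have [V [Vx [h [f sE]]]] := generatedP s Ux; exists V, h; split=> //.
have [t ft] := conn_matrix_ex nabla f.
have DE (D0 : principal_connection Omega (frame_sheaf L)) :
    mod_res h (D0 U s : mx_forms Omega n U) = D0 V (frame_section f).
  by rewrite /frame_section -sE; exact: (esym (pmap_res D0 h s)).
by rewrite !DE (H _ _ _ ft) (H' _ _ _ ft).
Qed.

Lemma connections_correspond :
  exists f : linear_connection Omega E -> principal_connection Omega (frame_sheaf L),
    bijective f /\ forall nabla D, f nabla = D <-> local_forms_agree nabla D.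
Proof.
apply: bijection_of_rel => [nabla|D|nabla D D'|nabla nabla' D].
- have [D H] := principal_of_linear nabla; exists D; exact/local_forms_agreeE.
- have [nabla H] := linear_of_principal D; exists nabla; exact/local_forms_agreeE.
- by move=> /local_forms_agreeE H /local_forms_agreeE; exact: same_matrices_fun.
- by move=> /local_forms_agreeE H /local_forms_agreeE; exact: same_matrices_inj.
Qed.



End Correspondence.

(** * The sheaf associated with the frames *)
Section Transport.
Variables (K : fieldType) (X : topologicalType) (A : algebra_sheaf K X).
Variables (F : presheaf X) (E : module_sheaf A).
Variables (f : psh_map F (mod_psh E)) (g : psh_map (mod_psh E) F).
Hypotheses (fK : forall V, cancel (f V) (g V)) (gK : forall V, cancel (g V) (f V)).

Let fD := fun V (s t : F V) => g V ((f V s : E V) + f V t).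
Let fZ := fun V (a : A V) (s : F V) => g V (a *: (f V s : E V)).
Let f0 := fun V => g V (0 : E V).
Let fN := fun V (s : F V) => g V (- (f V s : E V)).

(** The isomorphism f of sheaves of sets is linear from F, with the structure
    S, to E. *)
Definition linear_for (S : module_structure A F) : Prop :=
  forall V (a : A V) (s t : F V),
    f V (mst_add S (mst_scale S a s) t) = (a *: (f V s : E V) + f V t : E V).

Lemma transport_structure : exists S : module_structure A F,
  linear_for S /\ isomorphic E (module_of S).
Proof.
have addA V : associative (@fD V) by move=> s t u; rewrite /fD !gK addrA.
have addC V : commutative (@fD V) by move=> s t; rewrite /fD addrC.
have add0 V : left_id (@f0 V) (@fD V) by move=> s; rewrite /fD /f0 gK add0r fK.
have addN V : left_inverse (@f0 V) (@fN V) (@fD V).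
  by move=> s; rewrite /fD /fN gK addNr.
have scaleA V a b (s : F V) : fZ a (fZ b s) = fZ (a * b) s.
  by rewrite /fZ gK scalerA.
have scale1 V : left_id 1 (@fZ V) by move=> s; rewrite /fZ scale1r fK.
have scaleDr V : right_distributive (@fZ V) (@fD V).
  by move=> a s t; rewrite /fZ /fD !gK scalerDr.
have scaleDl V (s : F V) : {morph (@fZ V)^~ s : a b / a + b >-> fD a b}.
  by move=> a b; rewrite /fZ /fD !gK scalerDl.
have res (U V : opens X) (h : V `<=` U) (a : A U) (s t : F U) :
    pres h (fD (fZ a s) t) = fD (fZ (alg_res A h a) (pres h s)) (pres h t).
  rewrite /fD /fZ !gK -(pmap_res g) !(pmap_res f); congr (g V _); exact: mod_res_lin.
pose S := ModuleStructure addA addC add0 addN scaleA scale1 scaleDr scaleDl res.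
exists S; split; first by move=> V a s t; rewrite /= /fD /fZ !gK.
have g_lin (V : opens X) (h : V `<=` opensT) (a : A V) (s t : E V) :
    g V (a *: s + t) = mst_add S (mst_scale S a (g V s)) (g V t).
  by rewrite /= /fD /fZ !gK.
have g_res (V W : opens X) (h : V `<=` opensT) (h' : W `<=` opensT) (k : W `<=` V) (s : E V) :
    g W (mod_res k s) = pres k (g V s) by exact: pmap_res.
have g_bij (V : opens X) (h : V `<=` opensT) : bijective (g V) by exists (f V).
by exists; exact: (@IsoOn _ _ A opensT E (module_of S) (fun V _ => g V) g_lin g_res g_bij).
Qed.

(** Linearity of the injective f determines each operation of the structure. *)
Lemma module_structure_eq (S S' : module_structure A F) :
  linear_for S -> linear_for S' -> S = S'.
Proof.
have ops (T : module_structure A F) : linear_for T ->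
    [/\ mst_zero T = f0, mst_opp T = fN, mst_add T = fD & mst_scale T = fZ].
  move=> Tlin.
  (* With a = 1 and s = t = 0, linearity reads f 0 = f 0 + f 0. *)
  have fzero V : f V (mst_zero T V) = (0 : E V).
    apply: (addrI (f V (mst_zero T V) : E V)); rewrite addr0.
    have := Tlin V 1 (mst_zero T V) (mst_zero T V).
    by rewrite mst_scale1 mst_add0 scale1r => <-.
  have fadd V s t : f V (mst_add T s t) = ((f V s : E V) + f V t : E V).
    by have := Tlin V 1 s t; rewrite mst_scale1 scale1r.
  have fscale V a s : f V (mst_scale T a s) = (a *: (f V s : E V) : E V).
    by have := Tlin V a s (mst_zero T V); rewrite fzero addr0 mst_addC mst_add0.
  split; apply: functional_extensionality_dep => V.
  - by rewrite /f0 -fzero fK.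
  - apply/funext => s; apply: (can_inj (@fK V)); rewrite gK.
    by apply/eqP; rewrite -addr_eq0 -fadd mst_addN fzero.
  - by apply/funext => s; apply/funext => t; rewrite /fD -fadd fK.
  - by apply/funext => a; apply/funext => s; rewrite /fZ -fscale fK.
move=> /ops [z o a m] /ops [z' o' a' m']; rewrite -{}z' -{}o' -{}a' -{}m' in z o a m.
case: S S' z o a m => [z o a m q1 q2 q3 q4 q5 q6 q7 q8 q9].
move=> [z' o' a' m' r1 r2 r3 r4 r5 r6 r7 r8 r9] /= *; subst.
by congr ModuleStructure; exact: Prop_irrelevance.
Qed.

End Transport.

Section Associated.
Variables (K : fieldType) (X : topologicalType) (A : algebra_sheaf K X).
Variables (n : nat) (E : module_sheaf A) (L : local_frames n E).

Definition assoc_section (V : opens X) (f : frame L V) (a : 'cV[A V]_n) :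
    associated_sheaf (frame_sheaf L) V :=
  @eta X (assoc_presheaf (frame_sheaf L)) V (assoc_class (frame_section f) a).

Lemma assoc_section_res (U V : opens X) (h : V `<=` U) (f : frame L U) a :
  pres h (assoc_section f a) = assoc_section (frame_res h f) (mx_res h a).
Proof.
rewrite /assoc_section -(pmap_res (@eta X (assoc_presheaf (frame_sheaf L)))).
by congr (eta _ _); rewrite [LHS]assoc_resE frame_section_res.
Qed.

Lemma assoc_section_mul (V : opens X) (f : frame L V) (g : GL A n V) a :
  assoc_section (frame_mul f g) a = assoc_section f (g *m a).
Proof.
congr (eta _ _); apply/esym.
apply/(qpiP (assoc_rel_equiv (frame_sheaf L) V)); apply/assoc_relP.
exists g; split=> /=; first by rewrite [RHS]frame_section_mul.
by rewrite mulmxA gl_mulVmx mul1mx.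
Qed.

(** An identity [f, a] = [f, b] comes locally from some g with f = f.g; the
    action is free, so g = 1 and a = b locally. *)
Lemma assoc_section_inj (V : opens X) (f : frame L V) : injective (assoc_section f).
Proof.
move=> a b /eta_eqP e; apply: (sheaf_sep_loc (@mx_is_sheaf _ _ A n 1)) => x Vx.
have [W [h [Wx]]] := e x Vx; rewrite /= !assoc_resE.
move=> /(qpiP (assoc_rel_equiv (frame_sheaf L) W)).
move=> /assoc_relP [g [/= sg bE]]; exists W, h; split=> //=.
rewrite bE; have -> : g = @gl_one _ _ A n W.
  by apply: (@ps_act_free _ _ _ _ (frame_sheaf L) _ (pres h (frame_section f)));
    rewrite -[LHS]sg ps_act1.
by rewrite mul1mx.
Qed.

Lemma assoc_sectionP (U : opens X) (c : associated_sheaf (frame_sheaf L) U) x : U x ->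
  exists (V : opens X) (h : V `<=` U) (f : frame L V) a, V x /\ pres h c = assoc_section f a.
Proof.
move=> Ux; have [V [Vx [h [c' e]]]] := generatedP c Ux.
have [s [a c'E]] := assoc_classP c'; have [W [Wx [k [f fE]]]] := generatedP s Vx.
exists W, (subset_trans k h), f, (mx_res k a); split=> //.
rewrite -(pres_comp h k) e c'E -(pmap_res (@eta X (assoc_presheaf (frame_sheaf L)))).
by congr (eta _ _); rewrite [LHS]assoc_resE [pres k s]fE.
Qed.

Lemma PsiE (i : lf_index L) (V : opens X) (h : V `<=` lf_open i) (a : 'cV[A V]_n) :
  Psi h a = assoc_section (frame_res h (natural_frame i)) a.
Proof. by rewrite /assoc_section -frame_section_res. Qed.

Lemma assoc_iso : exists (f : psh_map (associated_sheaf (frame_sheaf L)) (mod_psh E))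
    (g : psh_map (mod_psh E) (associated_sheaf (frame_sheaf L))),
  [/\ forall V, cancel (f V) (g V), forall V, cancel (g V) (f V)
    & forall V (phi : frame L V) a, f V (assoc_section phi a) = frame_app phi a].
Proof.
pose r (V : opens X) (c : associated_sheaf (frame_sheaf L) V) (e : mod_psh E V) :=
  exists (f : frame L V) a, c = assoc_section f a /\ e = frame_app f a.
have [|||||||f [g [fK gK fE]]] := @sheaf_iso_of_rel X _ _ r.
- exact: generated_sheaf.
- exact: msh_is_sheaf.
- move=> U V h s t [f [a [-> ->]]]; exists (frame_res h f), (mx_res h a); split.
    exact: assoc_section_res.
  exact: (esym (frame_app_res h f a)).
- move=> V c e e' [f [a [-> ->]]] [f' [a' [ea ->]]].
  have [g f'E] := frame_transition f f'; move: ea.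
  by rewrite f'E assoc_section_mul frame_app_mul => /assoc_section_inj ->.
- move=> U c x Ux; have [V [h [f [a [Vx e]]]]] := assoc_sectionP c Ux.
  by exists V, h, (frame_app f a); split=> //; exists f, a.
- move=> V e c c' [f [a [-> ->]]] [f' [a' [-> ea]]].
  have [g f'E] := frame_transition f f'; move: ea.
  by rewrite f'E assoc_section_mul frame_app_mul => /frame_app_inj ->.
- move=> U e x Ux; have [V [h [f Vx]]] := frame_local L Ux.
  have [a aE] := frame_app_sur f (mod_res h e).
  by exists V, h, (assoc_section f a); split=> //; exists f, a.
by exists f, g; split=> // V phi a; apply: fE; exists phi, a.
Qed.

(** Under f, Psi is the natural frame acting on columns, which is linear; and
    all sections over an open set below U_i are values of Psi. *)
Lemma Psi_linearE (f : psh_map (associated_sheaf (frame_sheaf L)) (mod_psh E))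
    (g : psh_map (mod_psh E) (associated_sheaf (frame_sheaf L))) :
  (forall V, cancel (f V) (g V)) ->
  (forall V (phi : frame L V) a, f V (assoc_section phi a) = frame_app phi a) ->
  forall S : module_structure A (associated_sheaf (frame_sheaf L)),
  (forall (i : lf_index L) (V : opens X) (h : V `<=` lf_open i)
         (a : A V) (x y : 'cV[A V]_n),
         Psi h (a *: x + y) = mst_add S (mst_scale S a (Psi h x)) (Psi h y)) <->
  linear_for f S.
Proof.
move=> fK fE S; split=> [H U a s t|H i V h a x y]; last first.
  by apply: (can_inj (fK V)); rewrite H !PsiE !fE; exact: frame_appZD.
apply: (@module_sep _ _ _ E) => x Ux.
have [i xi] := lf_cover L (Logic.I : [set: X] x).
pose W := opensI U (lf_open i); pose h : W `<=` lf_open i := @opensIr _ _ _.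
pose k : W `<=` U := @opensIl _ _ _; exists W, k; split=> //.
have PsiP c : exists b : 'cV[A W]_n, c = Psi h b.
  have [b e] := frame_app_sur (frame_res h (natural_frame i)) (f W c).
  by exists b; apply: (can_inj (fK W)); rewrite PsiE fE.
have f_res c : mod_res k (f U c : E U) = f W (pres k c) by exact: (esym (pmap_res f k c)).
rewrite mod_res_lin !f_res mst_res.
have [b ->] := PsiP (pres k s); have [c ->] := PsiP (pres k t).
by rewrite -H !PsiE !fE; exact: frame_appZD.
Qed.

Lemma associated_to_frames :
  exists S : module_structure A (associated_sheaf (frame_sheaf L)),
    unique (fun S : module_structure A (associated_sheaf (frame_sheaf L)) =>
       forall (i : lf_index L) (V : opens X) (h : V `<=` lf_open i)
         (a : A V) (x y : 'cV[A V]_n),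
         Psi h (a *: x + y) = mst_add S (mst_scale S a (Psi h x)) (Psi h y)) S
     /\ isomorphic E (module_of S).
Proof.
have [f [g [fK gK fE]]] := assoc_iso.
have [S [Slin SE]] := transport_structure fK gK; exists S; split=> //.
split; first by apply/(Psi_linearE fK fE).
move=> S' /(Psi_linearE fK fE); exact: (module_structure_eq fK gK).
Qed.

End Associated.

Theorem corollary2 (R : realType) (k : ground_field) (X : topologicalType)
    (A : algebra_sheaf (scalars R k) X) (Omega : differential_triad A)
    (n : nat) (E : module_sheaf A) (L : local_frames n E) :
  (exists S : module_structure A (associated_sheaf (frame_sheaf L)),
     unique (fun S : module_structure A (associated_sheaf (frame_sheaf L)) =>
       forall (i : lf_index L) (V : opens X) (h : V `<=` lf_open i)
         (a : A V) (x y : 'cV[A V]_n),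
         Psi h (a *: x + y) = mst_add S (mst_scale S a (Psi h x)) (Psi h y)) S
     /\ isomorphic E (module_of S)) /\
  (exists f : linear_connection Omega E ->
              principal_connection Omega (frame_sheaf L),
     bijective f /\
     forall nabla D, f nabla = D <-> local_forms_agree nabla D).
Proof. by split; [exact: associated_to_frames|exact: connections_correspond]. Qed.
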